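(* Let $M\le\min\{P,K\}$, let $b\ge1$ be an integer, let $p_0>0$, let $\mathbf H\in\mathbb C^{P\times K}$, and let $\mathbf R_{vv}\in\mathbb C^{P\times P}$ be Hermitian positive definite. Let $$\alpha=\frac{\sqrt{4^b}-1}{b\sqrt{4^b}},\qquad\beta=\frac{3b}{4^b-1},\qquad\zeta=\frac{\sqrt{4^b}-2}{b\sqrt{4^b}},$$ and, for an MMSE-BDFD transceiver with error covariance matrix $\mathbf R_{ee}$, let $$\tilde P_e=\frac1M\sum_{i=1}^M\Bigl[\alpha\operatorname{erfc}\Bigl(\sqrt{\beta\bigl([\mathbf R_{ee}]_{ii}^{-1}-1\bigr)}\Bigr)+\zeta\operatorname{erfc}\Bigl(3\sqrt{\beta\bigl([\mathbf R_{ee}]_{ii}^{-1}-1\bigr)}\Bigr)\Bigr],$$ where $0\le[\mathbf R_{ee}]_{ii}<1$. There is a (reasonably large) threshold such that $\tilde P_e$ is convex in $[\mathbf R_{ee}]_{ii}$ when $[\mathbf R_{ee}]_{ii}$ is below that threshold. The MMSE design $(\mathbf F,\mathbf B,\mathbf W)$ specified in the context, which minimizes the arithmetic mean-square error $\operatorname{tr}(\mathbf R_{ee})/M$ over MMSE-BDFD transceivers with power bound $p_0$ and results in $\mathbf R_{ee}=\check\sigma_e^2\mathbf I$, also minimizes the bit error rate of the MMSE-BDFD at moderate-to-high SNRs, in the sense that it minimizes $\tilde P_e$ over MMSE-BDFD transceivers with power bound $p_0$ in the regime in which every $[\mathbf R_{ee}]_{ii}$ is below the threshold.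
   Context: All matrices are complex; $(\cdot)^H$ is the conjugate transpose, $(\cdot)^T$ the transpose, $\operatorname{erfc}(x)=\frac2{\sqrt\pi}\int_x^\infty e^{-z^2}dz$; $1/0$ is read as $+\infty$. Model. The received block is $\mathbf y=\mathbf H\mathbf F\mathbf s+\mathbf v$ with $E[\mathbf s\mathbf s^H]=\mathbf I$, $E[\mathbf s\mathbf v^H]=\mathbf 0$, $E[\mathbf v\mathbf v^H]=\mathbf R_{vv}$. An MMSE-BDFD (minimum mean-square error intra-block decision feedback detector) transceiver with power bound $p_0$ is a triple $(\mathbf F,\mathbf B,\mathbf W)$ with $\mathbf F\in\mathbb C^{K\times M}$, $\mathbf B\in\mathbb C^{M\times M}$ strictly upper triangular, $\operatorname{tr}(\mathbf F\mathbf F^H)\le p_0$ and $\mathbf W=(\mathbf B+\mathbf I)(\mathbf H\mathbf F)^H\bigl(\mathbf H\mathbf F(\mathbf H\mathbf F)^H+\mathbf R_{vv}\bigr)^{-1}$. Its error covariance at the decision point, assuming correct past decisions, is $\mathbf R_{ee}=(\mathbf B+\mathbf I)(\mathbf I+\mathbf F^H\mathbf H^H\mathbf R_{vv}^{-1}\mathbf H\mathbf F)^{-1}(\mathbf B+\mathbf I)^H$. The decision-point SINR of the $i$th element is $1/[\mathbf R_{ee}]_{ii}-1$. Approximating the residual intra-block interference on each element as Gaussian, $\tilde P_e$ approximates the average bit error rate under uniform bit loading with square QAM of $2b$ bits per symbol. MMSE design. Let $\mathbf H^H\mathbf R_{vv}^{-1}\mathbf H=\mathbf V\boldsymbol\Lambda\mathbf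 V^H$ be the eigenvalue decomposition with eigenvalues $\lambda_1\ge\cdots\ge\lambda_K$. Let $r\le K$ be the largest integer satisfying $1/\lambda_r<(p_0+\sum_{j=1}^r\lambda_j^{-1})/r$; $q=\min\{r,M\}$; $\tilde{\mathbf V}_q$ the first $q$ columns of $\mathbf V$; $\tilde{\boldsymbol\Lambda}_q=\operatorname{diag}(\lambda_1,\dots,\lambda_q)$; $\boldsymbol\Phi$ the $q\times q$ positive definite diagonal matrix with $|\phi_{ii}|^2=\frac1q(p_0+\sum_{j=1}^q\lambda_j^{-1})-\lambda_i^{-1}$; $\breve{\boldsymbol\Phi}=[\,\boldsymbol\Phi\ \ \mathbf 0_{q\times(M-q)}\,]$; $\check\sigma_e^2=q^{q/M}(p_0+\sum_{j=1}^q\lambda_j^{-1})^{-q/M}\prod_{j=1}^q\lambda_j^{-1/M}$. Let $\boldsymbol\Psi_{\rm MMSE}$ be the unitary matrix obtained by applying Algorithm A below to $\boldsymbol\Gamma=(\mathbf I_M+\breve{\boldsymbol\Phi}^T\tilde{\boldsymbol\Lambda}_q\breve{\boldsymbol\Phi})^{1/2}$, and let $\boldsymbol\Gamma\boldsymbol\Psi_{\rm MMSE}=\mathbf Q\check{\mathbf U}$ be the QR decomposition. Then $\mathbf F=\tilde{\mathbf V}_q\breve{\boldsymbol\Phi}\boldsymbol\Psi_{\rm MMSE}$, $\mathbf B=\check\sigma_e\check{\mathbf U}-\mathbf I$, and $\mathbf W$ is given by the MMSE-BDFD formula above. Algorithm A. Input: a diagonal non-singular $M\times M$ matrix $\boldsymbol\Gamma$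 with positive diagonal elements $\gamma_1\ge\cdots\ge\gamma_M$. Output: an $M\times M$ unitary matrix $\mathbf S$, with entries $s_{\ell k}$ and $k$th column $[\mathbf S]_{\cdot k}$, intended to make all diagonal elements of the R-factor of the QR decomposition of $\boldsymbol\Gamma\mathbf S$ equal to $(\prod_k\gamma_k)^{1/M}$. Notation: $g=(\prod_{k=1}^M\gamma_k^2)^{1/M}$; $\mathbf Z_k$ is the matrix of the first $k$ columns of $\mathbf S$; $\mathbf Z_k^\perp$ is an $M\times(M-k)$ matrix whose orthonormal columns span the orthogonal complement of the columns of $\mathbf Z_k$; $\mathcal P_{\mathbf A}=\mathbf I-\mathbf A(\mathbf A^H\mathbf A)^{-1}\mathbf A^H$; and $\mathbf A^{(k)}=(\boldsymbol\Gamma\mathbf Z_k^\perp)^H\mathcal P_{(\boldsymbol\Gamma\mathbf Z_k)}\boldsymbol\Gamma\mathbf Z_k^\perp$, of size $(M-k)\times(M-k)$. 1. Set $k=1$; $s_{11}=\sqrt{\frac{g-\gamma_M^2}{\gamma_1^2-\gamma_M^2}}$, $s_{M1}=\sqrt{\frac{\gamma_1^2-g}{\gamma_1^2-\gamma_M^2}}$, $s_{\ell1}=0$ for $2\le\ell\le M-1$. 2. Form $\mathbf A^{(k)}$ and its eigendecomposition $\mathbf A^{(k)}=\mathbf V^{(k)}\boldsymbol\Lambda^{(k)}(\mathbf V^{(k)})^H$, eigenvalues $\lambda^{(k)}_1\ge\cdots\ge\lambda^{(k)}_{M-k}$. 3. Set $[\mathbf S]_{\cdot k+1}=\mathbf Z_k^\perp\mathbf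 V^{(k)}\mathbf y^{(k)}$, where $y^{(k)}_1=\sqrt{\frac{g-\lambda^{(k)}_{M-k}}{\lambda^{(k)}_1-\lambda^{(k)}_{M-k}}}$, $y^{(k)}_{M-k}=\sqrt{\frac{\lambda^{(k)}_1-g}{\lambda^{(k)}_1-\lambda^{(k)}_{M-k}}}$, and $y^{(k)}_\ell=0$ for $2\le\ell\le M-k-1$. 4. Increment $k$. If $k\le M-2$ return to step 2. Otherwise set $[\mathbf S]_{\cdot M}=\mathbf Z_{M-2}^\perp\mathbf V^{(M-2)}\mathbf y^{(M-1)}$, where $y^{(M-1)}_1=-\sqrt{\frac{\lambda^{(M-2)}_1-g}{\lambda^{(M-2)}_1-\lambda^{(M-2)}_2}}$, $y^{(M-1)}_2=\sqrt{\frac{g-\lambda^{(M-2)}_2}{\lambda^{(M-2)}_1-\lambda^{(M-2)}_2}}$. *)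

(* Defs.v *)
From HB Require Import structures.
From mathcomp Require Import all_boot all_order all_algebra.
From mathcomp Require Import complex.
From mathcomp Require Import all_classical all_reals all_analysis.

Set Implicit Arguments.
Unset Strict Implicit.
Unset Printing Implicit Defensive.

Import Order.TTheory GRing.Theory Num.Theory.
Import numFieldNormedType.Exports.

Local Open Scope classical_set_scope.
Local Open Scope ring_scope.
Local Open Scope complex_scope.
Local Open Scope sesquilinear_scope.

(* Complex matrices have entries in [R[i]], [A ^t*] is the
   conjugate transpose, and on [R[i]] the order [x <= y] means that [y - x] is
   a nonnegative real.  Indices start at 0: [lam l] stands for the mathematical
   lambda_(l+1), and only the values at [l < n] of an eigenvalue list of an
   n x n matrix matter.  For [k <= n], [A *m pid_mx k : 'M_(m, k)] consists of
   the first k columns of [A : 'M_(m, n)]. *)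

Section Defs.
Variable R : realType.
Local Notation C := R[i].

Definition toC m n (A : 'M[R]_(m, n)) : 'M[C]_(m, n) :=
  map_mx (real_complex R) A.

Definition posdefmx n (A : 'M[C]_n) : Prop :=
  A \is hermsymmx /\
  forall v : 'cV[C]_n, v != 0 -> 0 < (v ^t* *m A *m v) 0 0.

Definition strictly_upper n (A : 'M[C]_n) : Prop :=
  forall i j : 'I_n, (j <= i)%N -> A i j = 0.

(* A = V diag(lam) V^H with V unitary and lam nonincreasing. *)
Definition eigdec n (A V : 'M[C]_n) (lam : nat -> R) : Prop :=
  [/\ V \is unitarymx,
      forall i j, (i <= j < n)%N -> lam j <= lam i
    & A = V *m toC (diag_mx (\row_(l < n) lam l)) *m V ^t*].

(* QR decomposition, normalized (hence unique for a nonsingular A) by a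
   positive real diagonal of the R-factor. *)
Definition QRdec n (A Q U : 'M[C]_n) : Prop :=
  [/\ Q \is unitarymx,
      forall i j : 'I_n, (j < i)%N -> U i j = 0,
      forall i : 'I_n, 0 < U i i
    & A = Q *m U].

(* Squared entries of y below, for extreme eigenvalues [a >= z].  For
   [a = z] (then also g = a = z, and any unit vector would do) the quotient
   0/0 is read as 1 in the first ratio and as 0 in the second one. *)
Definition ratio_hi (g a z : R) : R :=
  if a == z then 1 else (g - z) / (a - z).
Definition ratio_lo (g a z : R) : R :=
  if a == z then 0 else (a - g) / (a - z).

(* The unit vector y with y^H diag(lam) y = g, for n >= 2 supported on its
   first and last entries.  For n = 1 it is (1). *)
Definition eqdiag_y n (g : R) (lam : nat -> R) : 'cV[C]_n :=
  \col_(l < n)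
    (if l == 0%N :> nat then Num.sqrt (ratio_hi g (lam 0%N) (lam n.-1))
     else if l == n.-1 :> nat
       then Num.sqrt (ratio_lo g (lam 0%N) (lam n.-1)) else 0)%:C.

(* The companion of [eqdiag_y] orthogonal to it, used with n = 2. *)
Definition eqdiag_ylast n (g : R) (lam : nat -> R) : 'cV[C]_n :=
  \col_(l < n)
    (if l == 0%N :> nat then - Num.sqrt (ratio_lo g (lam 0%N) (lam 1%N))
     else Num.sqrt (ratio_hi g (lam 0%N) (lam 1%N)))%:C.

Definition proj_perp m n (A : 'M[C]_(m, n)) : 'M[C]_m :=
  1%:M - A *m invmx (A ^t* *m A) *m A ^t*.

Definition orth_compl_basis m n p (Z : 'M[C]_(m, n)) (Zp : 'M[C]_(m, p)) :
    Prop :=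
  Zp ^t* *m Zp = 1%:M /\
  forall v : 'cV[C]_m,
    Z ^t* *m v = 0 <-> exists c : 'cV[C]_p, v = Zp *m c.

Definition eqdiag_mx m n p (G : 'M[C]_m) (Z : 'M[C]_(m, n))
    (Zp : 'M[C]_(m, p)) : 'M[C]_p :=
  (G *m Zp) ^t* *m proj_perp (G *m Z) *m (G *m Zp).

(* [S] is an output of the column-by-column construction of a unitary S making
   the diagonal of the R-factor of Gamma S constant, for
   Gamma = diag(gam 0, ..., gam (M-1)).  The bases Z_k^perp and the
   eigendecompositions, which the construction leaves open, are [Zp] and
   [V], [lam].  The last column uses index M - 2; for M = 2 this is index 0,
   where Z_0^perp = V^(0) = I and A^(0) = Gamma^2, the data from which the
   first column is built.  For M = 1 there is only the first column, and
   S = (1). *)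
Definition equal_diag M (gam : nat -> R) (S : 'M[C]_M) : Prop :=
  let G := toC (diag_mx (\row_(l < M) gam l)) in
  let g := (\prod_(k < M) gam k ^+ 2) `^ (M%:R^-1) in
  exists (Zp : forall k, 'M[C]_(M, M - k)) (V : forall k, 'M[C]_(M - k))
         (lam : nat -> nat -> R),
  [/\ [/\ Zp 0%N = pid_mx M, V 0%N = 1%:M & forall l, lam 0%N l = gam l ^+ 2],
      forall j : 'I_M, j = 0%N :> nat ->
        col j S = eqdiag_y M g (fun l => gam l ^+ 2),
      forall k, (0 < k <= M - 2)%N ->
        orth_compl_basis (S *m (pid_mx k : 'M[C]_(M, k))) (Zp k) /\
        eigdec (eqdiag_mx G (S *m (pid_mx k : 'M[C]_(M, k))) (Zp k))
               (V k) (lam k),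
      forall k (j : 'I_M), (0 < k <= M - 2)%N -> j = k :> nat ->
        col j S = Zp k *m V k *m eqdiag_y (M - k) g (lam k)
    & forall j : 'I_M, (1 < M)%N -> j = M.-1 :> nat ->
        col j S = Zp (M - 2)%N *m V (M - 2)%N
                    *m eqdiag_ylast (M - (M - 2)) g (lam (M - 2)%N)].

Section Transceiver.
Variables (M P K : nat) (H : 'M[C]_(P, K)) (Rvv : 'M[C]_P) (p0 : R).

Definition mmse_receiver (F : 'M[C]_(K, M)) (B : 'M[C]_M) : 'M[C]_(M, P) :=
  (B + 1%:M) *m (H *m F) ^t* *m invmx (H *m F *m (H *m F) ^t* + Rvv).

Definition mmse_bdfd (F : 'M[C]_(K, M)) (B : 'M[C]_M) (W : 'M[C]_(M, P)) :
    Prop :=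
  [/\ strictly_upper B, \tr (F *m F ^t*) <= p0%:C & W = mmse_receiver F B].

Definition Ree (F : 'M[C]_(K, M)) (B : 'M[C]_M) : 'M[C]_M :=
  (B + 1%:M)
    *m invmx (1%:M + F ^t* *m H ^t* *m invmx Rvv *m H *m F)
    *m (B + 1%:M) ^t*.

(* The diagonal of R_ee, which is real. *)
Definition mse (F : 'M[C]_(K, M)) (B : 'M[C]_M) : 'rV[R]_M :=
  \row_i complex.Re (Ree F B i i).

(* 1/lambda_(i+1) < (p0 + sum_(j <= i+1) 1/lambda_j) / (i+1), in the extended
   reals, where [0^-1 = +oo]. *)
Definition water_cond (lam : nat -> R) (i : nat) : bool :=
  ((lam i)%:E^-1 <
   (p0%:E + \sum_(j < i.+1) (lam j)%:E^-1) * (i.+1%:R^-1)%:E)%E.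

(* r, with the value 0 when no positive integer qualifies (i.e. H = 0). *)
Definition water_r (lam : nat -> R) : nat :=
  \max_(i < K | water_cond lam i) i.+1.

Definition water_q (lam : nat -> R) : nat := minn (water_r lam) M.

Definition water_total (lam : nat -> R) : R :=
  p0 + \sum_(j < water_q lam) (lam j)^-1.

Definition phi (lam : nat -> R) (i : nat) : R :=
  Num.sqrt ((water_q lam)%:R^-1 * water_total lam - (lam i)^-1).

(* [Phi 0], of size q x M. *)
Definition Phi_breve (lam : nat -> R) : 'M[R]_(water_q lam, M) :=
  diag_mx (\row_(i < water_q lam) phi lam i) *m pid_mx (water_q lam).

Definition Lambda_q (lam : nat -> R) : 'M[R]_(water_q lam) :=
  diag_mx (\row_(i < water_q lam) lam i).

(* Diagonal of Gamma, the square root of the diagonal matrix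
   I + Phi_breve^T Lambda_q Phi_breve. *)
Definition gamma_row (lam : nat -> R) : 'rV[R]_M :=
  \row_i Num.sqrt
    ((1%:M + (Phi_breve lam)^T *m Lambda_q lam *m Phi_breve lam) i i).
Definition gamma (lam : nat -> R) (l : nat) : R :=
  if insub l is Some i then gamma_row lam 0 i else 0.

Definition sigma2 (lam : nat -> R) : R :=
  let q := water_q lam in
  q%:R `^ (q%:R / M%:R) * water_total lam `^ (- (q%:R / M%:R))
  * \prod_(j < q) lam j `^ (- (M%:R^-1)).

(* (F, B, W) is the MMSE design for some choice of the eigenvectors V, of the
   output Psi of the construction above and of the QR decomposition; [lam] lists the
   eigenvalues of H^H Rvv^-1 H. *)
Definition mmse_design (lam : nat -> R)
    (F : 'M[C]_(K, M)) (B : 'M[C]_M) (W : 'M[C]_(M, P)) : Prop :=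
  exists (V : 'M[C]_K) (Psi Q U : 'M[C]_M),
  [/\ eigdec (H ^t* *m invmx Rvv *m H) V lam,
      equal_diag (gamma lam) Psi,
      QRdec (toC (diag_mx (gamma_row lam)) *m Psi) Q U
    & [/\ F = V *m pid_mx (water_q lam) *m toC (Phi_breve lam) *m Psi,
          B = (Num.sqrt (sigma2 lam))%:C *: U - 1%:M
        & W = mmse_receiver F B]].

End Transceiver.

(* On the extended reals, so that erfc +oo = 0. *)
Definition erfc (x : \bar R) : R :=
  2 / Num.sqrt pi *
  \int[lebesgue_measure]_(z in [set z : R | (x <= z%:E)%E]) expR (- z ^+ 2).

Definition ber_alpha (b : nat) : R :=
  (Num.sqrt (4 ^+ b) - 1) / (b%:R * Num.sqrt (4 ^+ b)).
Definition ber_beta (b : nat) : R := 3 * b%:R / (4 ^+ b - 1).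
Definition ber_zeta (b : nat) : R :=
  (Num.sqrt (4 ^+ b) - 2) / (b%:R * Num.sqrt (4 ^+ b)).

(* sqrt(beta (1/x - 1)), equal to +oo at x = 0. *)
Definition ber_arg (b : nat) (x : R) : \bar R :=
  sqrte ((ber_beta b)%:E * (x%:E^-1 - 1))%E.

Definition ber_term (b : nat) (x : R) : R :=
  ber_alpha b * erfc (ber_arg b x)
  + ber_zeta b * erfc (3%:E * ber_arg b x)%E.

(* The approximate bit error rate as a function of the vector x of the
   diagonal entries of R_ee. *)
Definition ber (b M : nat) (x : 'rV[R]_M) : R :=
  M%:R^-1 * \sum_(i < M) ber_term b (x 0 i).

(* 1/x - 1 = 3 / (2 beta) at x = [tau_min b]: beyond this SINR the arguments of
   both erfc terms leave the region where convexity in x can fail. *)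
Definition tau_min (b : nat) : R :=
  2 * ber_beta b / (2 * ber_beta b + 3).

Definition ber_convex_below (b M : nat) (tau : R) : Prop :=
  @convex_function R 'rV[R]_M
    [set x : 'rV[R]_M | forall i, 0 <= x 0 i < tau] (@ber b M).

End Defs.

(* Main.v *)
(* The error covariance is N (I + F^H A F)^-1 N^H with A = H^H Rvv^-1 H and
   N = B + I unit upper triangular, so its determinant does not depend on B.
   By Hadamard and AM-GM its mean diagonal entry is at least
   det (I + F^H A F)^(-1/M).  Compressing A to the column space of F cannot
   increase the ordered eigenvalues, so this determinant is at most
   prod_(i < M) (1 + lambda_i x_i) for some x_i >= 0 of sum at most p0, and
   water-filling (1 + t <= exp t at the optimal level) bounds it by
   sigma^(-2M).  The design attains the bound because the R-factor of
   Gamma Psi has a constant diagonal: column k+1 multiplies the determinant of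
   the Gram matrix of the leading columns by y^H Lambda^(k) y = g.  The
   required y exists since A^(k), a Schur complement, has determinant
   g^(M-k), whence g lies between its extreme eigenvalues.
   The error rate is a mean of values of one nondecreasing convex function at
   the entries of the diagonal, so by Jensen only the mean entry matters. *)

Require Import Defs.
From HB Require Import structures.
From mathcomp Require Import all_boot all_order all_algebra.
From mathcomp Require Import perm complex.
From mathcomp Require Import all_classical all_reals all_analysis.
From mathcomp Require Import measurable_realfun.
From mathcomp Require Import ring lra.

Set Implicit Arguments.
Unset Strict Implicit.
Unset Printing Implicit Defensive.

Import Order.TTheory GRing.Theory Num.Theory.
Import numFieldNormedType.Exports.

Local Open Scope ring_scope.

(** * Determinants and Hermitian matrices *)

Section ComplexMatrices.
Local Open Scope sesquilinear_scope.
Variable C : numClosedFieldType.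

(** The optimality claim holds for every threshold below which the error rate is convex, so its
    proof cannot rest on the explicit derivative: convexity of one summand is recovered by
    restricting [ber] to constant vectors, and only monotonicity comes from the formula. The
    derivative serves to exhibit one threshold. Up to a constant it is f(u) = e^(-ku) (1+u)^2 / sqrt
    u with u = 1/x - 1, and (ln f)' = -k + 2/(1+u) - 1/(2u) <= -k + 3/(2u). This is the origin of
    3/(2k); the smaller of the two rates, beta against 9 beta, fixes [tau_min]. Degenerate data
    shape the rest: eigenvalues may vanish or coincide, and q may be 0, in which case no power is
    spent and sigma^2 = 1. The invariant of the construction is a Gram determinant rather than a
    triangular factor, so that each column costs one Schur complement and no factorization is
    updated. *)

Lemma trmxC_mul m n p (A : 'M[C]_(m, n)) (B : 'M[C]_(n, p)) :
  (A *m B) ^t* = B ^t* *m A ^t*.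
Proof. by rewrite trmx_mul map_mxM. Qed.

Lemma trmxC1 n : (1%:M : 'M[C]_n) ^t* = 1%:M.
Proof. by rewrite trmx1 map_mx1. Qed.

Lemma det_trmxC n (A : 'M[C]_n) : \det (A ^t*) = (\det A)^*.
Proof. by rewrite det_map_mx det_tr. Qed.

Lemma invmx_trmxC n (A : 'M[C]_n) : A \in unitmx ->
  (invmx A) ^t* = invmx (A ^t*).
Proof. by move=> uA; rewrite trmx_inv map_invmx. Qed.

Lemma unitmx_trmxC n (A : 'M[C]_n) : (A ^t* \in unitmx) = (A \in unitmx).
Proof. by rewrite map_unitmx unitmx_tr. Qed.

Lemma mulmx_trmxC_diag m n (A : 'M[C]_(m, n)) i :
  (A *m A ^t*) i i = \sum_j `|A i j| ^+ 2.
Proof. by rewrite mxE; apply: eq_bigr => j _; rewrite !mxE normCK. Qed.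

Lemma det_block_schur n1 n2 (A : 'M[C]_n1) B D (E : 'M[C]_n2) :
  A \in unitmx ->
  \det (block_mx A B D E) = \det A * \det (E - D *m invmx A *m B).
Proof.
move=> uA.
have -> : block_mx A B D E =
    block_mx 1%:M 0 (D *m invmx A) 1%:M *m block_mx A B 0 (E - D *m invmx A *m B).
  rewrite mulmx_block !mul1mx !mul0mx !addr0 mulmxKV //.
  by rewrite addrCA subrr addr0.
by rewrite det_mulmx det_lblock !det1 !mul1r det_ublock.
Qed.

(** Sylvester's identity, from two block triangular factorizations of one matrix. *)
Lemma det1_mulC m n (A : 'M[C]_(m, n)) (B : 'M[C]_(n, m)) :
  \det (1%:M + A *m B) = \det (1%:M + B *m A).
Proof.
have E1 : block_mx 1%:M (- A) B 1%:M =
    block_mx (1%:M + A *m B) (- A) 0 1%:M *m block_mx 1%:M 0 B 1%:M.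
  rewrite mulmx_block ?(mul1mx,mulmx1,mulmx0,mul0mx) ?(add0r,addr0).
  by rewrite mulNmx addrK.
have E2 : block_mx 1%:M (- A) B 1%:M =
    block_mx 1%:M 0 B 1%:M *m block_mx 1%:M (- A) 0 (1%:M + B *m A).
  rewrite mulmx_block ?(mul1mx,mulmx1,mulmx0,mul0mx,addr0).
  by rewrite mulmxN addrCA addNr addr0.
have := E1; rewrite E2 => /(congr1 determinant).
by rewrite !det_mulmx !det_lblock !det_ublock !det1 !mul1r !mulr1 => ->.
Qed.

(** Gram-Schmidt on the rows. A rank-deficient [A] is allowed: [B] still has orthonormal rows, and
    only the diagonal of [L] may then vanish. *)
Lemma schmidt_LQ m n (A : 'M[C]_(m, n)) : (m <= n)%N ->
  exists (L : 'M[C]_m) (B : 'M[C]_(m, n)),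
  [/\ B \is unitarymx, A = L *m B,
      forall i j : 'I_m, (i < j)%N -> L i j = 0
    & forall i, 0 <= L i i].
Proof.
move=> le_mn; set B := schmidt A.
have uB : B \is unitarymx by exact: schmidt_unitarymx.
exists (A *m B ^t*), B; split => //.
- have /submxP[X EX] := schmidt_sub A.
  by rewrite {2}EX -/B (mulmxtVK _ uB) -EX.
- move=> i j lt_ij.
  have EL : (A *m B ^t*) i j = dotmx (row i A) (row j B).
    by rewrite dotmxE !mxE; apply: eq_bigr => k _; rewrite !mxE.
  rewrite EL; apply/eqP; rewrite -orthomxE.
  apply: submx_trans (row_schmidt_sub A i) _.
  apply/sumsmx_subP => k le_ki; rewrite genmxE orthomxE -/B.
  move: (row_unitarymxP uB k j).
  rewrite -val_eqE /= ltn_eqF ?(leq_ltn_trans le_ki) // => /eqP.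
  exact.
- move=> i; have := form1_row_schmidt A i.
  rewrite dotmxE !mxE; congr (_ <= _).
  by apply: eq_bigr => k _; rewrite !mxE.
Qed.

Lemma det_lower_prod n (L : 'M[C]_n) :
  (forall i j : 'I_n, (i < j)%N -> L i j = 0) -> \det L = \prod_i L i i.
Proof. by move=> L0; apply: det_trig; apply/is_trig_mxP. Qed.

Lemma det_upper_prod n (U : 'M[C]_n) :
  (forall i j : 'I_n, (j < i)%N -> U i j = 0) -> \det U = \prod_i U i i.
Proof.
move=> U0; rewrite -det_tr det_lower_prod => [|i j ij]; last by rewrite mxE U0.
by apply: eq_bigr => i _; rewrite mxE.
Qed.

(** In A = L B the factor B cancels. The determinant is the product of the |L_ii|^2, while the ith
    diagonal entry is the squared norm of the whole ith row of L. *)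
Lemma hadamard m n (A : 'M[C]_(m, n)) : (m <= n)%N ->
  \det (A *m A ^t*) <= \prod_i (A *m A ^t*) i i.
Proof.
move=> /(schmidt_LQ A)[L [B [uB -> L0 _]]].
rewrite trmxC_mul mulmxA (mulmxtVK _ uB) det_mulmx det_trmxC -normCK.
rewrite det_lower_prod // normr_prod -prodrXl; apply: ler_prod => i _.
rewrite exprn_ge0 // mulmx_trmxC_diag (bigD1 i) //= lerDl.
by apply: sumr_ge0 => j _; rewrite exprn_ge0.
Qed.

End ComplexMatrices.

Section HermitianForms.
Local Open Scope sesquilinear_scope.
Variable C : numClosedFieldType.

Lemma diag_quad n (w : 'rV[C]_n) (d : 'rV[C]_n) :
  (w *m diag_mx d *m w ^t*) 0 0 = \sum_l d 0 l * `|w 0 l| ^+ 2.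
Proof.
rewrite mul_mx_diag mxE; apply: eq_bigr => l _.
by rewrite !mxE normCK mulrAC mulrC.
Qed.

Lemma row_quad n (w : 'rV[C]_n) : (w *m w ^t*) 0 0 = \sum_l `|w 0 l| ^+ 2.
Proof. by rewrite mulmx_trmxC_diag. Qed.

(* Some nonzero combination of the first i+1 rows of U has its first i
   coordinates equal to 0; both quadratic forms are compared on it. *)
Lemma compression_eigenvalue_le m n (le_mn : (m <= n)%N) (U : 'M[C]_(m, n))
    (d : 'rV[C]_n) (c : 'rV[C]_m) (i : 'I_m) :
  U \is unitarymx -> U *m diag_mx d *m U ^t* = diag_mx c ->
  (forall l : 'I_n, (i <= l)%N -> d 0 l <= d 0 (widen_ord le_mn i)) ->
  (forall j : 'I_m, (j <= i)%N -> c 0 i <= c 0 j) ->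
  c 0 i <= d 0 (widen_ord le_mn i).
Proof.
move=> uU Ec dle cle.
(* A left null vector of [X] meets all constraints at once: columns before i make the coordinates of
   the combination vanish, columns after i kill its later coefficients, and the zero column i makes
   [X] singular. *)
pose X : 'M[C]_m := \matrix_(j, l)
  if (l < i)%N then U j (widen_ord le_mn l)
  else if l == i then 0 else (j == l)%:R.
have /eqP/det0P[a a0 aX] : \det X = 0.
  rewrite (expand_det_col _ i) big1 // => j _.
  by rewrite mxE ltnn eqxx mul0r.
have aX0 l : \sum_j a 0 j * X j l = 0.
  by have /rowP/(_ l) := aX; rewrite !mxE.
have a_gt (l : 'I_m) : (i < l)%N -> a 0 l = 0.
  move=> il; have := aX0 l; rewrite (bigD1 l) //= big1 => [|j jl].
    rewrite mxE ltnNge ltnW //= -val_eqE /= gtn_eqF // eqxx mulr1 addr0.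
    by [].
  by rewrite mxE ltnNge ltnW //= -val_eqE /= gtn_eqF // (negbTE jl) mulr0.
pose w := a *m U.
have w_lt (l : 'I_n) : (l < i)%N -> w 0 l = 0.
  move=> li; have lm : (l < m)%N := ltn_trans li (ltn_ord i).
  rewrite -[RHS](aX0 (Ordinal lm)) mxE.
  apply: eq_bigr => j _; rewrite mxE /= li; congr (_ * U _ _).
  exact: val_inj.
have Ew : \sum_l `|w 0 l| ^+ 2 = \sum_j `|a 0 j| ^+ 2.
  by rewrite -!row_quad /w trmxC_mul mulmxA (mulmxtVK _ uU).
have N_gt0 : 0 < \sum_j `|a 0 j| ^+ 2.
  have [j aj] : exists j, a 0 j != 0.
    apply/existsP; apply: contraNT a0 => /existsPn a0.
    by apply/eqP/rowP => j; rewrite mxE; apply/eqP; have := a0 j; rewrite negbK.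
  rewrite (bigD1 j) //= ltr_pwDl ?exprn_gt0 ?normr_gt0 //.
  by apply: sumr_ge0 => ? _; rewrite exprn_ge0.
have Eq : \sum_l d 0 l * `|w 0 l| ^+ 2 = \sum_j c 0 j * `|a 0 j| ^+ 2.
  rewrite -!diag_quad /w trmxC_mul -Ec.
  by rewrite !mulmxA.
rewrite -(ler_pM2r N_gt0) (@le_trans _ _ (\sum_j c 0 j * `|a 0 j| ^+ 2)) //.
  rewrite mulr_sumr; apply: ler_sum => j _.
  have [ji|ij] := leqP j i; first by rewrite ler_wpM2r ?exprn_ge0 // cle.
  by rewrite a_gt // normr0 expr0n !mulr0.
rewrite -Eq -Ew mulr_sumr; apply: ler_sum => l _.
have [il|li] := leqP i l; first by rewrite ler_wpM2r ?exprn_ge0 // dle.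
by rewrite w_lt // normr0 expr0n !mulr0.
Qed.

(** By Sylvester's identity the determinant is that of the Gram matrix of the rows of
    [I, sqrt(c) Y^H], to which [hadamard] applies. This decouples the modes: only the diagonal of
    Y^H Y survives. *)
Lemma det1_hadamard m (Y : 'M[C]_m) (c : 'rV[C]_m) :
  (forall i, 0 <= c 0 i) ->
  \det (1%:M + Y *m diag_mx c *m Y ^t*) <=
  \prod_i (1 + c 0 i * (Y ^t* *m Y) i i).
Proof.
move=> c0; pose s : 'rV[C]_m := \row_i sqrtC (c 0 i).
have ss : diag_mx s *m diag_mx s = diag_mx c.
  rewrite mulmx_diag; congr diag_mx; apply/rowP => i.
  by rewrite !mxE -expr2 sqrtCK.
have sH : (diag_mx s) ^t* = diag_mx s.
  rewrite tr_diag_mx map_diag_mx; congr diag_mx; apply/rowP => i.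
  by rewrite !mxE; apply: geC0_conj; rewrite sqrtC_ge0.
have Es (X : 'M[C]_m) i :
    (diag_mx s *m X *m diag_mx s) i i = c 0 i * X i i.
  by rewrite mul_mx_diag mul_diag_mx !mxE mulrAC -expr2 sqrtCK.
pose A := row_mx 1%:M (diag_mx s *m Y ^t*).
have EA : A *m A ^t* = 1%:M + diag_mx s *m Y ^t* *m Y *m diag_mx s.
  rewrite tr_row_mx map_col_mx mul_row_col trmxC1 mulmx1 trmxC_mul trmxCK sH.
  by rewrite !mulmxA.
have -> : \det (1%:M + Y *m diag_mx c *m Y ^t*) = \det (A *m A ^t*).
  by rewrite EA -ss mulmxA -(mulmxA (Y *m _)) det1_mulC !mulmxA.
apply: le_trans (hadamard _ _) _; first exact: leq_addr.
apply: ler_prod => i _; apply/andP; split.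
  by rewrite mulmx_trmxC_diag; apply: sumr_ge0 => j _; rewrite exprn_ge0.
by rewrite EA mxE [1%:M i i]mxE eqxx -(mulmxA (diag_mx s)) Es.
Qed.

End HermitianForms.

(** * Ordered eigendecompositions and the determinant bound by modes *)

Section Eigen.
Local Open Scope sesquilinear_scope.
Local Open Scope complex_scope.
Variable R : realType.
Local Notation C := R[i].

Definition crow n (lam : nat -> R) : 'rV[C]_n := \row_(l < n) (lam l)%:C.

Lemma toC_diag n (lam : nat -> R) :
  toC (diag_mx (\row_(l < n) lam l)) = diag_mx (crow n lam).
Proof. by rewrite /toC map_diag_mx; congr diag_mx; apply/rowP => i; rewrite !mxE. Qed.

Lemma hermsymmxP n (A : 'M[C]_n) : reflect (A ^t* = A) (A \is hermsymmx).
Proof.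
by rewrite is_hermitianmxE expr0 scale1r eq_sym; apply: eqP.
Qed.

(** The spectral theorem lists the eigenvalues in no particular order; sorting them gives a
    permutation, which is then applied to the eigenvectors. *)
Lemma hermitian_eigdec n (A : 'M[C]_n) : A ^t* = A ->
  exists V lam, eigdec A V lam.
Proof.
move=> /hermsymmxP hA.
have /orthomx_spectralP := hermitian_normalmx hA.
have := hermitian_spectral_diag_real hA.
set P := spectralmx A; set sp := spectral_diag A => sp_real.
have uP : P \is unitarymx := spectral_unitarymx A.
rewrite (invmx_unitary uP) => EA.
pose t := [tuple complex.Re (sp 0 i) | i < n].
pose s := sort >=%O t.
have /tuple_permP[p Ep] : perm_eq (sort >=%O t) t by rewrite perm_sort.
have Enth (i : 'I_n) : (nth 0 s i)%:C = sp 0 (p i).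
  rewrite /s Ep.
  rewrite (nth_map i) ?size_enum_ord // nth_ord_enum tnth_mktuple.
  by rewrite RRe_real // (mxOverP sp_real).
have size_s : size s = n by rewrite size_sort size_tuple.
have sumJ (f : 'I_n -> C) : \sum_j f (p j) = \sum_j f j.
  by rewrite [RHS](reindex_inj (@perm_inj _ p)).
have ePP i j : \sum_k P k i * (P k j)^*%R = (P ^t* *m P) j i.
  by rewrite mxE; apply: eq_bigr => k _; rewrite !mxE mulrC.
have uP' : P ^t* *m P = 1%:M.
  by apply: mulmx1C; apply/unitarymxP.
exists (col_perm p (P ^t*)), (nth 0 s); split.
- apply/unitarymxP/matrixP => i j; rewrite mxE.
  under eq_bigr do rewrite !mxE.
  rewrite (sumJ (fun k => (P k i)^* * ((P k j)^*)^*))%R.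
  under eq_bigr do rewrite conjCK.
  rewrite -uP' mxE; apply: eq_bigr => k _.
  by rewrite !mxE.
- move=> i j /andP[le_ij lt_jn].
  have /(sorted_leq_nth (@ge_trans _ R)) : sorted >=%O s.
    by apply: sort_sorted => x y; exact: le_total.
  move=> /(_ (@lexx _ R) 0 i j); rewrite !inE size_s => H; apply: H => //.
  exact: leq_ltn_trans lt_jn.
- rewrite toC_diag {1}EA; apply/matrixP => i j.
  rewrite !mul_mx_diag [LHS]mxE [RHS]mxE.
  rewrite -sumJ; apply: eq_bigr => k _.
  by rewrite !mxE Enth conjCK.
Qed.

Lemma eigdec_diag n (A V : 'M[C]_n) lam : eigdec A V lam ->
  V ^t* *m A *m V = diag_mx (crow n lam).
Proof.
move=> [/unitarymxP/mulmx1C uV _ ->].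
by rewrite toC_diag !mulmxA uV mul1mx -mulmxA uV mulmx1.
Qed.

Lemma eigdec_ge0 n (A V : 'M[C]_n) lam : eigdec A V lam ->
  (forall v : 'cV[C]_n, 0 <= (v ^t* *m A *m v) 0 0) ->
  forall l, (l < n)%N -> 0 <= lam l.
Proof.
move=> dA A0 l ln; have /matrixP/(_ (Ordinal ln) (Ordinal ln)) := eigdec_diag dA.
rewrite [RHS]mxE eqxx mulr1n [RHS]mxE /= => E.
rewrite -ler0c -E; have := A0 (col (Ordinal ln) V).
rewrite [in X in X -> _]mxE [in X in _ -> X]mxE; congr (_ <= _).
apply: eq_bigr => i _; rewrite [in LHS]mxE [in RHS]mxE.
rewrite [col _ _ _ _]mxE; congr (_ * _).
by apply: eq_bigr => j _; rewrite !mxE.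
Qed.

Lemma eigdec_det n (A V : 'M[C]_n) lam : eigdec A V lam ->
  \det A = (\prod_(l < n) lam l)%:C.
Proof.
move=> dA; have [/unitarymxP uV _ EA] := dA.
rewrite EA !det_mulmx mulrAC -det_mulmx uV det1 mul1r.
by rewrite toC_diag det_diag rmorph_prod; apply: eq_bigr => i _; rewrite mxE.
Qed.

(** Write F^H V = L B with orthonormal rows in B, and diagonalize the compression of diag(lam) by B
    as E diag(c) E^H, so that c <= lam. With Y = L E the matrix becomes I + Y diag(c) Y^H. The
    powers x_i are the diagonal entries of Y^H Y, and their sum is tr(L L^H) = tr(F F^H). *)
Lemma det_mode_bound m n (A V : 'M[C]_n) lam (F : 'M[C]_(n, m)) :
  (m <= n)%N -> eigdec A V lam -> (forall l, (l < n)%N -> 0 <= lam l) ->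
  exists x : 'I_m -> R,
  [/\ forall i, 0 <= x i, (\sum_i x i)%:C = \tr (F *m F ^t*)
    & \det (1%:M + F ^t* *m A *m F) <= (\prod_(i < m) (1 + lam i * x i))%:C].
Proof.
move=> le_mn dA lam0; have [uV lam_dec EA] := dA.
pose d := crow n lam.
pose G := V ^t* *m F.
have EG : F ^t* *m A *m F = G ^t* *m diag_mx d *m G.
  by rewrite EA toC_diag /G trmxC_mul trmxCK !mulmxA.
have trG : \tr (F *m F ^t*) = \tr (G ^t* *m G).
  rewrite mxtrace_mulC /G trmxC_mul trmxCK mulmxA -(mulmxA (F ^t*)).
  by rewrite (unitarymxP uV) mulmx1.
have [L [B [uB EL _ _]]] := schmidt_LQ (G ^t*) le_mn.
have hd : (diag_mx d) ^t* = diag_mx d.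
  rewrite tr_diag_mx map_diag_mx; congr diag_mx.
  by apply/rowP => i; rewrite !mxE; apply: conjc_real.
have [E [c dE]] : exists E c, eigdec (B *m diag_mx d *m B ^t*) E c.
  by apply: hermitian_eigdec; rewrite !trmxC_mul trmxCK hd mulmxA.
have [uE c_dec EE] := dE.
pose U := E ^t* *m B.
have uU : U \is unitarymx by rewrite mul_unitarymx // trmxC_unitary.
have EU : U *m diag_mx d *m U ^t* = diag_mx (crow m c).
  by rewrite -(eigdec_diag dE) /U trmxC_mul trmxCK !mulmxA.
have c_le (i : 'I_m) : c i <= lam i.
  rewrite -lecR; have := @compression_eigenvalue_le _ _ _ le_mn U d (crow m c) i uU EU.
  rewrite !mxE; apply=> [l il|j ji]; rewrite !mxE lecR.
    by apply: lam_dec; rewrite il /=.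
  by apply: c_dec; rewrite ji /=.
have c_ge0 (i : 'I_m) : 0 <= c i.
  apply: (eigdec_ge0 dE) => // v.
  have := diag_quad (v ^t* *m B) d; rewrite trmxC_mul trmxCK !mulmxA => ->.
  apply: sumr_ge0 => l _; rewrite mulr_ge0 ?exprn_ge0 // mxE ler0c.
  exact: lam0.
pose Y := L *m E.
have EY : G ^t* *m diag_mx d *m G = Y *m diag_mx (crow m c) *m Y ^t*.
  rewrite -{2}(trmxCK G) EL -EU /Y /U !trmxC_mul !trmxCK.
  rewrite !mulmxA -(mulmxA L E) (unitarymxP uE) mulmx1.
  by rewrite -!mulmxA (mulmxA E) (unitarymxP uE) mul1mx.
have Yreal i : exists r, 0 <= r /\ (Y ^t* *m Y) i i = r%:C.
  have Y0 : 0 <= (Y ^t* *m Y) i i.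
    rewrite -{2}(trmxCK Y) mulmx_trmxC_diag.
    by apply: sumr_ge0 => j _; rewrite exprn_ge0.
  have /complex_realP[r Er] := ger0_real Y0.
  by exists r; rewrite -ler0c -Er.
have [x xP] := choice Yreal.
exists x; split=> [i||]; first by case: (xP i).
- rewrite trG -{2}(trmxCK G) EL trmxC_mul mulmxA (mulmxtVK _ uB).
  have -> : L *m L ^t* = Y *m Y ^t*.
    by rewrite /Y trmxC_mul mulmxA -(mulmxA L) (unitarymxP uE) mulmx1.
  rewrite mxtrace_mulC rmorph_sum; apply: eq_bigr => i _.
  by case: (xP i) => _ ->.
- rewrite EG EY; apply: le_trans (@det1_hadamard _ _ Y (crow m c) _) _ => [i|].
    by rewrite mxE ler0c c_ge0.
  rewrite rmorph_prod /=; apply: ler_prod => i _.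
  have [x0 ->] := xP i; rewrite mxE.
  have -> : 1 + (c i)%:C * (x i)%:C = (1 + c i * x i)%:C.
    by rewrite rmorphD rmorph1 rmorphM.
  rewrite !lecR.
  by rewrite addr_ge0 ?ler01 ?mulr_ge0 //= lerD2l ler_wpM2r.
Qed.

End Eigen.

(** * Water-filling and the lower bound on the mean-square error *)

Section Waterfilling.
Variables (R : realType) (M K : nat) (p0 : R) (lam : nat -> R).
Hypotheses (M_gt0 : (0 < M)%N) (M_le_K : (M <= K)%N) (p0_gt0 : 0 < p0).
Hypothesis lam_ge0 : forall l, (l < K)%N -> 0 <= lam l.
Hypothesis lam_dec : forall i j, (i <= j < K)%N -> lam j <= lam i.

Let T k := p0 + \sum_(j < k) (lam j)^-1.

Let T_S k : T k.+1 = T k + (lam k)^-1.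
Proof. by rewrite /T big_ord_recr addrA. Qed.

Let lam_gt0_down i j : (i <= j < K)%N -> 0 < lam j -> 0 < lam i.
Proof. by move=> /lam_dec ij /lt_le_trans; apply. Qed.

Let T_gt0 k : (k <= K)%N -> 0 < T k.
Proof.
move=> kK; rewrite ltr_wpDr //; apply: sumr_ge0 => j _.
by rewrite invr_ge0 lam_ge0 // (leq_trans (ltn_ord j)).
Qed.

(** Multiplying by i + 1 and cancelling one copy of 1/lambda leaves a finite test whose sum stops
    before i. A zero eigenvalue puts +oo on the left, and the test fails. *)
Lemma water_condP i : (i < K)%N ->
  reflect (0 < lam i /\ i%:R / lam i < T i) (water_cond p0 lam i).
Proof.
move=> iK; rewrite /water_cond.
have [li0|li_neq0] := eqVneq (lam i) 0.
  by rewrite li0 inver eqxx /= [(+oo < _)%E]ltNge leey; constructor; case; rewrite ltxx.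
have li_gt0 : 0 < lam i by rewrite lt_neqAle eq_sym li_neq0 lam_ge0.
have -> : (\sum_(j < i.+1) (lam j)%:E^-1)%E = (\sum_(j < i.+1) (lam j)^-1)%:E.
  rewrite -sumEFin; apply: eq_bigr => j _; rewrite inver gt_eqF //.
  by apply: lam_gt0_down li_gt0; rewrite iK andbT -ltnS.
rewrite inver (negbTE li_neq0) -EFinD -EFinM lte_fin -[p0 + _]/(T i.+1).
rewrite ltr_pdivlMr ?ltr0n // T_S -addn1 natrD mulrDr mulr1 ltrD2r mulrC.
by apply: (iffP idP) => [|[]].
Qed.

(** [water_r] is a maximum over the qualifying indices; downward closure turns it into a cut, with
    every index below it qualifying. From j+1 to j the step uses lam (j+1) <= lam j and cancels
    1/lam j. *)
Lemma water_cond_down i j : (i <= j < K)%N ->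
  water_cond p0 lam j -> water_cond p0 lam i.
Proof.
elim: j => [|j IHj]; first by rewrite leqn0 => /andP[/eqP->].
rewrite leq_eqVlt ltnS => /andP[/orP[/eqP->//|ij] jK].
move=> /(water_condP jK)[lj1 Hj]; apply: IHj; first by rewrite ij ltnW.
have jK' := ltnW jK; have lj : 0 < lam j by apply: lam_gt0_down lj1; rewrite leqnSn.
apply/(water_condP jK'); split=> //.
have : j.+1%:R / lam j <= j.+1%:R / lam j.+1.
  by rewrite ler_wpM2l // lef_pV2 ?posrE // lam_dec // leqnSn.
rewrite T_S in Hj => /le_lt_trans/(_ Hj).
by rewrite -addn1 natrD mulrDl mul1r ltrD2r.
Qed.

Lemma ltn_water_r i : (i < K)%N -> (i < water_r K p0 lam)%N = water_cond p0 lam i.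
Proof.
move=> iK; apply/idP/idP => [|ci]; last exact: (bigop.bigmax_sup (Ordinal iK)).
apply: contraTT => nci; rewrite -leqNgt; apply/bigmax_leqP => j cj.
rewrite ltnNge; apply: contra nci => ij.
by apply: water_cond_down cj; rewrite ij ltn_ord.
Qed.

Local Notation q := (water_q M K p0 lam).
Local Notation Tq := (water_total M K p0 lam).

Lemma water_q_le : (q <= M)%N. Proof. exact: geq_minr. Qed.

Let qK : (q <= K)%N. Proof. exact: leq_trans water_q_le M_le_K. Qed.

Lemma water_total_gt0 : 0 < Tq. Proof. exact: T_gt0. Qed.

Let cond_lt_q i : (i < q)%N -> 0 < lam i /\ i%:R / lam i < T i.
Proof.
move=> iq; have iK := leq_trans iq qK.
apply/(water_condP iK); rewrite -ltn_water_r //.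
exact: leq_trans iq (geq_minl _ _).
Qed.

Lemma water_lam_gt0 i : (i < q)%N -> 0 < lam i.
Proof. by move=> /cond_lt_q[]. Qed.

(** The condition at the last active index q - 1 says exactly that its 1/lambda lies under the level
    with q modes, even when q was cut down to M; earlier indices have smaller 1/lambda. *)
Lemma water_level_gt i : (i < q)%N -> (lam i)^-1 < q%:R^-1 * Tq.
Proof.
move=> iq; have q_gt0 : (0 < q)%N := leq_trans (ltn0Sn _) iq.
have Eq : q = q.-1.+1 by rewrite prednK.
have [lm_gt0 Hm] : 0 < lam q.-1 /\ q.-1%:R / lam q.-1 < T q.-1.
  by apply: cond_lt_q; rewrite -Eq.
have li_le : (lam i)^-1 <= (lam q.-1)^-1.
  have q1 : (q.-1 < K)%N by rewrite -Eq.
  have i_le : (i <= q.-1)%N by rewrite -ltnS -Eq.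
  rewrite lef_pV2 ?posrE ?(water_lam_gt0 iq) //.
  by apply: lam_dec; rewrite i_le.
apply: le_lt_trans li_le _.
rewrite mulrC ltr_pdivlMr ?ltr0n // -[Tq]/(T q) Eq T_S -{2}addn1 natrD mulrDr.
by rewrite mulr1 ltrD2r mulrC.
Qed.

(** An index between q and M exists only if q was not cut down to M, so q = r and the condition
    fails at q. That failure bounds lam q, hence all later eigenvalues. *)
Lemma water_lam_le i : (q <= i < M)%N -> lam i * Tq <= q%:R.
Proof.
move=> /andP[qi iM]; have qM : (q < M)%N := leq_ltn_trans qi iM.
have qK' := leq_trans qM M_le_K.
have Er : q = water_r K p0 lam.
  by move: qM; rewrite /water_q; case: (leqP (water_r _ _ _) M); rewrite ?ltnn.
have li_le : lam i <= lam q.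
  by apply: lam_dec; rewrite qi (leq_trans iM).
apply: le_trans (_ : lam q * Tq <= _).
  by rewrite ler_wpM2r // ltW // water_total_gt0.
have [->|lq_neq0] := eqVneq (lam q) 0; first by rewrite mul0r.
have lq_gt0 : 0 < lam q by rewrite lt_neqAle eq_sym lq_neq0 lam_ge0.
rewrite mulrC -ler_pdivlMr // leNgt; apply/negP => Hq.
have : water_cond p0 lam q by apply/(water_condP qK').
by rewrite -ltn_water_r // -Er ltnn.
Qed.

Let sum_lt_q (f : nat -> R) : \sum_(i < M) (if (i < q)%N then f i else 0) = \sum_(i < q) f i.
Proof. by rewrite -big_mkcond (big_ord_widen _ f water_q_le). Qed.

Let prod_lt_q (f : nat -> R) : \prod_(i < M) (if (i < q)%N then f i else 1) = \prod_(i < q) f i.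
Proof. by rewrite -big_mkcond (big_ord_widen _ f water_q_le). Qed.

Lemma water_bound (x : 'I_M -> R) : (forall i, 0 <= x i) -> \sum_i x i <= p0 ->
  \prod_(i < M) (1 + lam i * x i) <= \prod_(i < q) (lam i * (q%:R^-1 * Tq)).
Proof.
(* For q = 0 there is no water level; [water_lam_le] then makes the first M eigenvalues vanish, and
   both products are 1. *)
move=> x0 sx; have [q0|q_gt0] := posnP q.
  rewrite q0 big_ord0 big1 // => i _.
  have := @water_lam_le i; rewrite q0 /= ltn_ord => /(_ isT).
  rewrite pmulr_lle0 ?water_total_gt0 // => li0.
  by rewrite (@le_anti _ _ (lam i) 0) ?mul0r ?addr0 // li0 lam_ge0 // (leq_trans (ltn_ord i)).
set nu := q%:R^-1 * Tq.
have q_neq0 : q%:R != 0 :> R by rewrite pnatr_eq0 -lt0n.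
have nu_gt0 : 0 < nu by rewrite mulr_gt0 ?water_total_gt0 // invr_gt0 ltr0n.
(* [y i] is the factor at the optimum. On an active mode 1 + lam x = y (1 + e) with relative excess
   e = (1/lam + x)/nu - 1; on an inactive one lam <= 1/nu gives at most 1 + x/nu. The power
   constraint makes the sum of these excesses nonpositive. *)
pose y i := if (i < q)%N then lam i * nu else 1.
pose a i := if (i < q)%N then (lam i)^-1 / nu - 1 else 0.
have -> : \prod_(i < q) (lam i * nu) = \prod_(i < M) y i.
  by rewrite (prod_lt_q (fun i => lam i * nu)).
have y_ge0 i : 0 <= y i.
  by rewrite /y; case: ifP => // iq; rewrite mulr_ge0 ?ltW // water_lam_gt0.
apply: le_trans (_ : \prod_(i < M) (y i * expR (a i + x i / nu)) <= _).
  apply: ler_prod => i _; apply/andP; split.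
    by rewrite addr_ge0 // mulr_ge0 // lam_ge0 // (leq_trans (ltn_ord i)).
  apply: le_trans (_ : y i * (1 + (a i + x i / nu)) <= _); last first.
    by rewrite ler_wpM2l // expR_ge1Dx.
  rewrite /y /a; case: ifPn => [iq|]; last first.
    rewrite -leqNgt => qi; rewrite mul1r lerD2l add0r mulrC ler_wpM2l //.
    have := @water_lam_le i; rewrite qi ltn_ord => /(_ isT).
    rewrite /nu invfM invrK -ler_pdivlMr ?water_total_gt0 //.
  have li := water_lam_gt0 iq; rewrite le_eqVlt; apply/orP; left; apply/eqP.
  by field; rewrite !gt_eqF.
rewrite big_split /= -expR_sum ler_piMr ?prodr_ge0 // -[leRHS]expR0 ler_expR.
rewrite big_split /= (sum_lt_q (fun i => (lam i)^-1 / nu - 1)).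
rewrite sumrB sumr_const card_ord -!mulr_suml addrAC -mulrDl subr_le0.
rewrite ler_pdivrMr // /nu mulrA mulfV // mul1r addrC.
by rewrite lerD2r.
Qed.

Lemma sigma2_gt0 : 0 < sigma2 M K p0 lam.
Proof.
rewrite /sigma2; apply: mulr_gt0; first apply: mulr_gt0.
- by case: (posnP q) => [->|q0]; rewrite ?mul0r ?powRr0 // powR_gt0 // ltr0n.
- by rewrite powR_gt0 // water_total_gt0.
- by apply: prodr_gt0 => j _; rewrite powR_gt0 // water_lam_gt0.
Qed.

(** Identifies the closed formula for sigma^2 with the bound of [water_bound], free of fractional
    powers. For q = 0 both factors are 1. *)
Lemma sigma2_expM :
  sigma2 M K p0 lam ^+ M * \prod_(i < q) (lam i * (q%:R^-1 * Tq)) = 1.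
Proof.
have M_neq0 : M%:R != 0 :> R by rewrite pnatr_eq0 -lt0n.
have powM a x : 0 <= a -> (a `^ x) ^+ M = a `^ (x * M%:R).
  by move=> a0; rewrite -powR_mulrn ?powR_ge0 // powRrM.
have T0 := water_total_gt0.
rewrite /sigma2 !exprMn !powM ?ler0n ?(ltW T0) // mulNr divfK //.
rewrite powRN !powR_mulrn ?ler0n ?(ltW T0) // -prodrXl -!mulrA -big_split /=.
under eq_bigr => i _.
  rewrite powM ?(ltW (water_lam_gt0 _)) // mulNr mulVf // powRN powRr1 ?(ltW (water_lam_gt0 _)) //.
  rewrite mulrA mulVf ?gt_eqF ?water_lam_gt0 // mul1r.
  over.
rewrite prodr_const card_ord exprMn exprVn.
have [q0|q0] := posnP q; first by rewrite q0 !expr0 invr1 !mulr1.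
have q_neq0 : q%:R != 0 :> R by rewrite pnatr_eq0 -lt0n.
by field; rewrite !expf_neq0 // gt_eqF.
Qed.

End Waterfilling.

(** * Error covariance of an arbitrary transceiver *)

Section Transceivers.
Local Open Scope sesquilinear_scope.
Local Open Scope complex_scope.
Variable R : realType.
Local Notation C := R[i].

Lemma invmx_mul n (A B : 'M[C]_n) : A \in unitmx -> B \in unitmx ->
  invmx (A *m B) = invmx B *m invmx A.
Proof.
move=> uA uB; have uAB : A *m B \in unitmx by rewrite unitmx_mul uA.
apply: (can_inj (mulKmx uAB)).
by rewrite mulmxV // !mulmxA mulmxK // mulmxV.
Qed.

Lemma posdefmx_unit n (A : 'M[C]_n) : posdefmx A -> A \in unitmx.
Proof.
move=> [/hermsymmxP hA pA]; rewrite unitmxE unitfE; apply/negP => /det0P[v v0 vA].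
have := pA (v ^t*); rewrite trmxCK vA mul0mx mxE ltxx => H.
suff : false by []; apply: H; apply: contraNneq v0 => vH.
by rewrite -(trmxCK v) vH trmx0 map_mx0.
Qed.

Section Channel.
Variables (P K : nat) (H : 'M[C]_(P, K)) (Rvv : 'M[C]_P).
Hypothesis Rvv_posdef : posdefmx Rvv.

Definition channel_gram : 'M[C]_K := H ^t* *m invmx Rvv *m H.

Let uR : Rvv \in unitmx := posdefmx_unit Rvv_posdef.

Let hR : Rvv ^t* = Rvv.
Proof. by case: Rvv_posdef => /hermsymmxP. Qed.

Lemma channel_gram_herm : channel_gram ^t* = channel_gram.
Proof. by rewrite /channel_gram !trmxC_mul trmxCK invmx_trmxC // hR mulmxA. Qed.

Lemma channel_gram_ge0 (v : 'cV[C]_K) : 0 <= (v ^t* *m channel_gram *m v) 0 0.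
Proof.
pose w := invmx Rvv *m (H *m v).
have -> : v ^t* *m channel_gram *m v = w ^t* *m Rvv *m w.
  rewrite /w /channel_gram !trmxC_mul invmx_trmxC // hR !mulmxA.
  by rewrite (mulmxKV uR).
have [->|w0] := eqVneq w 0; first by rewrite mulmx0 mxE.
by apply: ltW; case: Rvv_posdef => _; apply.
Qed.

Section Error.
Variables (M : nat) (V : 'M[C]_K) (lam : nat -> R).
Hypothesis dH : eigdec channel_gram V lam.

Lemma channel_lam_ge0 l : (l < K)%N -> 0 <= lam l.
Proof. by apply: (eigdec_ge0 dH); exact: channel_gram_ge0. Qed.

(** The matrix is W W^H for W = [I, F^H V sqrt(Lambda)], and LQ makes the factor square. It is
    invertible because a row v with v L = 0 gives v W = 0, whose identity block is v itself. *)
Lemma gram_factor (F : 'M[C]_(K, M)) :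
  exists2 L : 'M[C]_M, L \in unitmx &
    1%:M + F ^t* *m channel_gram *m F = L *m L ^t*.
Proof.
pose s : 'rV[C]_K := \row_i (Num.sqrt (lam i))%:C.
have sH : (diag_mx s) ^t* = diag_mx s.
  rewrite tr_diag_mx map_diag_mx; congr diag_mx.
  by apply/rowP => i; rewrite !mxE; apply: conjc_real.
have ss : diag_mx s *m diag_mx s = diag_mx (crow K lam).
  rewrite mulmx_diag; congr diag_mx; apply/rowP => i.
  by rewrite !mxE -rmorphM -expr2 sqr_sqrtr // channel_lam_ge0.
pose W := row_mx 1%:M (F ^t* *m V *m diag_mx s).
have EW : W *m W ^t* = 1%:M + F ^t* *m channel_gram *m F.
  rewrite tr_row_mx map_col_mx mul_row_col trmxC1 mulmx1 !trmxC_mul trmxCK sH.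
  have [_ _ ->] := dH; rewrite toC_diag -ss.
  by rewrite !mulmxA.
have [L [B [uB EL _ _]]] := schmidt_LQ W (leq_addr _ _).
exists L; last by rewrite -EW EL trmxC_mul mulmxA (mulmxtVK _ uB).
rewrite unitmxE unitfE; apply/negP => /det0P[v v0 vL].
have : (v *m W *m (v *m W) ^t*) 0 0 = 0.
  by rewrite EL mulmxA vL mul0mx mul0mx mxE.
rewrite row_quad => /eqP; rewrite psumr_eq0 => [/allP vW|l _]; last first.
  by rewrite exprn_ge0.
case/negP: v0; apply/eqP/rowP => i; rewrite mxE.
have /implyP/(_ isT) := vW (lshift K i) (mem_index_enum _).
by rewrite /W mul_mx_row mulmx1 row_mxEl expf_eq0 /= normr_eq0 => /eqP.
Qed.

Lemma det_unit_upper (B : 'M[C]_M) : strictly_upper B -> \det (B + 1%:M) = 1.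
Proof.
move=> B0; rewrite det_upper_prod => [|i j ji].
  by apply: big1 => i _; rewrite !mxE eqxx B0 // add0r.
by rewrite !mxE B0 1?ltnW // -val_eqE /= gtn_eqF // addr0.
Qed.

Lemma ReeE (F : 'M[C]_(K, M)) (B : 'M[C]_M) :
  Ree H Rvv F B = (B + 1%:M) *m invmx (1%:M + F ^t* *m channel_gram *m F)
                    *m (B + 1%:M) ^t*.
Proof. by rewrite /Ree /channel_gram !mulmxA. Qed.

(** The Gram form shows that the diagonal is real and nonnegative, and it is the shape required by
    [hadamard]. *)
Lemma Ree_factor (F : 'M[C]_(K, M)) (B : 'M[C]_M) :
  exists X : 'M[C]_M, Ree H Rvv F B = X *m X ^t*.
Proof.
have [L uL EL] := gram_factor F; exists ((B + 1%:M) *m invmx (L ^t*)).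
rewrite ReeE EL invmx_mul ?unitmx_trmxC // trmxC_mul invmx_trmxC ?unitmx_trmxC //.
by rewrite trmxCK !mulmxA.
Qed.

Lemma Ree_diag (F : 'M[C]_(K, M)) (B : 'M[C]_M) i :
  Ree H Rvv F B i i = (mse H Rvv F B 0 i)%:C /\ 0 <= mse H Rvv F B 0 i.
Proof.
have [X EX] := Ree_factor F B.
have Rii : 0 <= Ree H Rvv F B i i.
  by rewrite EX mulmx_trmxC_diag; apply: sumr_ge0 => j _; rewrite exprn_ge0.
rewrite -ler0c [mse _ _ _ _ _ _]mxE RRe_real ?ger0_real //.
Qed.

Lemma tr_Ree (F : 'M[C]_(K, M)) (B : 'M[C]_M) :
  \tr (Ree H Rvv F B) = (\sum_i mse H Rvv F B 0 i)%:C.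
Proof. by rewrite rmorph_sum; apply: eq_bigr => i _; case: (Ree_diag F B i). Qed.

(** All quantities are compared as Mth powers, so that no root of a determinant occurs: sigma^(2M) =
    1/D <= det R_ee <= product of the diagonal <= mean^M. *)
Lemma mse_mean_ge (p0 : R) (F : 'M[C]_(K, M)) (B : 'M[C]_M) :
  (0 < M)%N -> (M <= K)%N -> 0 < p0 ->
  strictly_upper B -> \tr (F *m F ^t*) <= p0%:C ->
  sigma2 M K p0 lam <= (\sum_i mse H Rvv F B 0 i) / M%:R.
Proof.
move=> M_gt0 M_le_K p0_gt0 suB trF; have [uV lam_dec _] := dH.
have [x [x0 sx detG]] := det_mode_bound F M_le_K dH channel_lam_ge0.
rewrite -sx lecR in trF.
have Dge := water_bound M_le_K p0_gt0 channel_lam_ge0 lam_dec x0 trF.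
have sD := sigma2_expM M_gt0 M_le_K p0_gt0 channel_lam_ge0 lam_dec.
have s_gt0 := sigma2_gt0 M_le_K p0_gt0 channel_lam_ge0 lam_dec.
set D := \prod_(i < water_q _ _ _ _) _ in Dge sD.
set s := sigma2 M K p0 lam in sD s_gt0 *.
have sM_gt0 : 0 < s ^+ M by rewrite exprn_gt0.
have D_gt0 : 0 < D by rewrite -(pmulr_rgt0 _ sM_gt0) sD.
have [L uL EL] := gram_factor F.
have detRee : \det (Ree H Rvv F B) = (`|\det L| ^+ 2)^-1.
  rewrite ReeE EL !det_mulmx det_trmxC det_unit_upper // conjC1 mul1r mulr1.
  by rewrite det_inv det_mulmx det_trmxC -normCK.
have detL_gt0 : 0 < `|\det L| ^+ 2.
  by rewrite exprn_gt0 // normr_gt0 -unitfE -unitmxE.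
have detL_le : `|\det L| ^+ 2 <= D%:C.
  rewrite normCK -det_trmxC -det_mulmx -EL; apply: le_trans detG _.
  by rewrite lecR.
have [X EX] := Ree_factor F B.
have s_le : s ^+ M <= \prod_i mse H Rvv F B 0 i.
  rewrite -lecR rmorph_prod /=.
  under eq_bigr do rewrite -(proj1 (Ree_diag F B _)).
  have := hadamard X (leqnn M); rewrite -EX detRee; apply: le_trans.
  have -> : (s ^+ M)%:C = (D%:C)^-1.
    rewrite -fmorphV; congr _%:C; apply: (mulIf (lt0r_neq0 D_gt0)).
    by rewrite sD mulVf // gt_eqF.
  by rewrite lef_pV2 ?posrE // (ltcR 0).
have mse0 i : 0 <= mse H Rvv F B 0 i by case: (Ree_diag F B i).
rewrite -(ler_pXn2r M_gt0) ?nnegrE ?(ltW s_gt0) ?divr_ge0 ?sumr_ge0 //.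
apply: le_trans s_le _.
have [] := @leif_AGM _ _ predT (fun i => mse H Rvv F B 0 i) (fun i _ => mse0 i).
by rewrite card_ord.
Qed.

End Error.
End Channel.
End Transceivers.

(** * Equal-diagonal QR decomposition *)

Section EqualDiagonal.
Local Open Scope sesquilinear_scope.
Local Open Scope complex_scope.
Variable R : realType.
Local Notation C := R[i].

Lemma orth_compl_basis_mul0 m n p (Z : 'M[C]_(m, n)) (Zp : 'M[C]_(m, p)) :
  orth_compl_basis Z Zp -> Z ^t* *m Zp = 0.
Proof.
move=> [_ H]; apply/matrixP => i j.
have /matrixP/(_ i 0) : Z ^t* *m (Zp *m delta_mx j (0 : 'I_1)) = 0.
  by apply/H; exists (delta_mx j 0).
by rewrite mulmxA -colE !mxE.
Qed.

(** [p] is kept apart from [m - n] so that it can be replaced by the rank of the complement, whose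
    row basis is then orthonormalized. *)
Lemma orth_compl_basis_exists m n p (Z : 'M[C]_(m, n)) :
  Z ^t* *m Z = 1%:M -> p = (m - n)%N ->
  exists Zp : 'M[C]_(m, p), orth_compl_basis Z Zp.
Proof.
move=> ZZ Ep.
pose X := orthomx Num.conj (mx_of_hermitian (hermitian1mx m)) (Z ^t*).
have uZ : Z ^t* \is unitarymx by apply/unitarymxP; rewrite trmxCK.
have {Ep} -> : p = \rank X by rewrite rank_ortho (mxrank_unitary uZ).
pose B := schmidt (row_base X).
have uB : B \is unitarymx by rewrite schmidt_unitarymx // rank_leq_col.
have BX : (B :=: X)%MS.
  by apply: (eqmx_trans (eqmx_schmidt_free (row_base_free X))); apply: eq_row_base.
exists (B ^t*); split; first by rewrite trmxCK; apply/unitarymxP.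
move=> v; have Hv : (v ^t* <= X)%MS <-> Z ^t* *m v = 0.
  have e := @orthomx1P _ _ _ _ (v ^t*) (Z ^t*); rewrite trmxCK in e.
  split => [/e vZ|Zv]; last apply/e.
    by rewrite -(trmxCK (_ *m v)) trmxC_mul trmxCK vZ trmx0 map_mx0.
  by rewrite -(trmxCK (_ *m Z)) trmxC_mul trmxCK Zv trmx0 map_mx0.
rewrite -Hv -BX; split => [/submxP[c Ec]|[c ->]].
  by exists (c ^t*); rewrite -(trmxCK v) Ec trmxC_mul.
by rewrite trmxC_mul trmxCK submxMl.
Qed.

Section ProjPerp.
Variables (m n : nat) (Y : 'M[C]_(m, n)).
Hypothesis uN : Y ^t* *m Y \in unitmx.

Lemma proj_perp_herm : (proj_perp Y) ^t* = proj_perp Y.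
Proof.
have hiN : (invmx (Y ^t* *m Y)) ^t* = invmx (Y ^t* *m Y).
  by rewrite invmx_trmxC // trmxC_mul trmxCK.
rewrite /proj_perp; set N := invmx _ in hiN *.
by rewrite linearB /= map_mxB trmxC1 !trmxC_mul trmxCK hiN mulmxA.
Qed.

Lemma proj_perp_idem : proj_perp Y *m proj_perp Y = proj_perp Y.
Proof.
have NN := mulmxV uN; rewrite /proj_perp; set N := invmx _ in NN *.
have YY : Y *m N *m Y ^t* *m (Y *m N *m Y ^t*) = Y *m N *m Y ^t*.
  by rewrite -!mulmxA (mulmxA (Y ^t*) Y) (mulmxA (Y ^t* *m Y)) NN mul1mx.
by rewrite mulmxBr mulmx1 mulmxBl mul1mx YY subrr subr0.
Qed.

End ProjPerp.

Section Gram.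
Variables (m n : nat) (G : 'M[C]_m) (Z : 'M[C]_(m, n)).
Hypothesis uN : (G *m Z) ^t* *m (G *m Z) \in unitmx.

Lemma eqdiag_mx_herm p (Zp : 'M[C]_(m, p)) :
  (eqdiag_mx G Z Zp) ^t* = eqdiag_mx G Z Zp.
Proof.
have := proj_perp_herm uN; rewrite /eqdiag_mx; set Q := proj_perp _ => QH.
by rewrite [in LHS]trmxC_mul [in LHS](trmxC_mul _ Q) trmxCK QH mulmxA.
Qed.

Lemma eqdiag_mx_mul p r (Zp : 'M[C]_(m, p)) (c : 'M[C]_(p, r)) :
  eqdiag_mx G Z (Zp *m c) = c ^t* *m eqdiag_mx G Z Zp *m c.
Proof. by rewrite /eqdiag_mx !trmxC_mul !mulmxA. Qed.

Lemma eqdiag_mx_ge0 p (Zp : 'M[C]_(m, p)) (v : 'cV[C]_p) :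
  0 <= (v ^t* *m eqdiag_mx G Z Zp *m v) 0 0.
Proof.
have := proj_perp_idem uN; have := proj_perp_herm uN.
rewrite -eqdiag_mx_mul /eqdiag_mx; set Q := proj_perp _ => QH QQ.
move: (G *m _) => w.
have -> : w ^t* *m Q *m w = (Q *m w) ^t* *m (Q *m w) ^t* ^t*.
  by rewrite trmxCK trmxC_mul QH !mulmxA -[in RHS](mulmxA (w ^t*)) QQ.
rewrite mulmx_trmxC_diag.
by apply: sumr_ge0 => j _; rewrite exprn_ge0.
Qed.

(** [eqdiag_mx G Z Zp] is the Schur complement of the first block in the Gram matrix of G [Z Zp]. *)
Lemma det_gram_row_mx p (Zp : 'M[C]_(m, p)) :
  \det ((G *m row_mx Z Zp) ^t* *m (G *m row_mx Z Zp)) =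
  \det ((G *m Z) ^t* *m (G *m Z)) * \det (eqdiag_mx G Z Zp).
Proof.
rewrite mul_mx_row /eqdiag_mx /proj_perp; move: (G *m Z) (G *m Zp) uN => Y X uY.
rewrite tr_row_mx map_col_mx mul_col_row (det_block_schur _ _ _ uY); congr (_ * \det _).
by rewrite mulmxBr mulmx1 mulmxBl !mulmxA.
Qed.

End Gram.

(** Since [Z Zp] is unitary, the Gram determinant of G [Z Zp] is that of G. This gives the
    determinant of A^(k) without any knowledge of its eigenvalues. *)
Lemma det_gram_complement m n p (G : 'M[C]_m) (Z : 'M[C]_(m, n))
    (Zp : 'M[C]_(m, p)) :
  (n + p = m)%N -> Z ^t* *m Z = 1%:M -> orth_compl_basis Z Zp ->
  (G *m Z) ^t* *m (G *m Z) \in unitmx ->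
  \det ((G *m Z) ^t* *m (G *m Z)) * \det (eqdiag_mx G Z Zp) = \det (G ^t* *m G).
Proof.
move=> Em; case: m / Em in G Z Zp *.
move=> ZZ ocb uN; rewrite -det_gram_row_mx //.
have ZZp := orth_compl_basis_mul0 ocb; case: ocb => ZpZp _.
have ZpZ : Zp ^t* *m Z = 0.
  by rewrite -(trmxCK (_ *m Z)) trmxC_mul trmxCK ZZp trmx0 map_mx0.
have WW : (row_mx Z Zp) ^t* *m row_mx Z Zp = 1%:M.
  rewrite tr_row_mx map_col_mx mul_col_row ZZ ZZp ZpZ ZpZp.
  by rewrite -scalar_mx_block.
rewrite trmxC_mul -mulmxA det_mulmx mulrC !mulmxA -det_mulmx.
rewrite -!mulmxA (mulmx1C WW) mulmx1.
by [].
Qed.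

Section Eqdiag_y.
Variables (n : nat) (g : R) (lam : nat -> R).
Hypotheses (n_gt0 : (0 < n)%N) (g_gt0 : 0 < g).
Hypothesis lam_ge0 : forall l, (l < n)%N -> 0 <= lam l.
Hypothesis lam_dec : forall i j, (i <= j < n)%N -> lam j <= lam i.
Hypothesis lam_prod : \prod_(l < n) lam l = g ^+ n.

Lemma geom_mean_le_max : g <= lam 0%N.
Proof.
rewrite -(ler_pXn2r n_gt0) ?nnegrE ?lam_ge0 ?(ltW g_gt0) // -lam_prod.
have -> : lam 0%N ^+ n = \prod_(l < n) lam 0%N by rewrite prodr_const card_ord.
 apply: ler_prod => l _.
by rewrite lam_ge0 //= lam_dec /=.
Qed.

Lemma min_le_geom_mean : lam n.-1 <= g.
Proof.
have n1 : (n.-1 < n)%N by rewrite prednK.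
rewrite -(ler_pXn2r n_gt0) ?nnegrE ?lam_ge0 ?(ltW g_gt0) // -lam_prod.
have -> : lam n.-1 ^+ n = \prod_(l < n) lam n.-1 by rewrite prodr_const card_ord.
 apply: ler_prod => l _.
by rewrite lam_ge0 //= lam_dec // n1 -ltnS prednK // ltn_ord.
Qed.

Let hi := ratio_hi g (lam 0%N) (lam n.-1).
Let lo := ratio_lo g (lam 0%N) (lam n.-1).

Let hi_ge0 : 0 <= hi.
Proof.
rewrite /hi /ratio_hi; case: ifP => // _.
have := geom_mean_le_max; have := min_le_geom_mean => zg ga.
by rewrite divr_ge0 ?subr_ge0 // (le_trans zg).
Qed.

Let lo_ge0 : 0 <= lo.
Proof.
rewrite /lo /ratio_lo; case: ifP => // _.
have := geom_mean_le_max; have := min_le_geom_mean => zg ga.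
by rewrite divr_ge0 ?subr_ge0 // (le_trans zg).
Qed.

Let hi_lo : hi + lo = 1.
Proof.
rewrite /hi /lo /ratio_hi /ratio_lo; case: eqVneq => [_|ne]; first by rewrite addr0.
by rewrite -mulrDl addrC subrKA mulfV // subr_eq0.
Qed.

Let lam_hi_lo : lam 0%N * hi + lam n.-1 * lo = g.
Proof.
rewrite /hi /lo /ratio_hi /ratio_lo; case: eqVneq => [e|ne].
  rewrite mulr1 mulr0 addr0; apply/le_anti.
  by rewrite geom_mean_le_max {1}e min_le_geom_mean.
field; by rewrite subr_eq0.
Qed.

Let sum_y (f : nat -> R) : ((eqdiag_y n g lam) ^t* *m
   diag_mx (crow n f) *m eqdiag_y n g lam) 0 0 = (f 0%N * hi + f n.-1 * lo)%:C.
Proof.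
have := diag_quad ((eqdiag_y n g lam) ^t*) (crow n f); rewrite trmxCK => ->.
have E (l : 'I_n) : crow n f 0 l * `|((eqdiag_y n g lam) ^t*) 0 l| ^+ 2 =
    (f l * (if l == 0%N :> nat then hi else if l == n.-1 :> nat then lo else 0))%:C.
  rewrite !mxE norm_conjC rmorphM; congr (_ * _).
  rewrite -/hi -/lo normc_def /= expr0n addr0 sqrtr_sqr -rmorphXn /= real_normK ?num_real //.
  by congr _%:C; do 2?case: ifP => _; rewrite ?sqr_sqrtr // expr0n.
under eq_bigr do rewrite E.
rewrite -rmorph_sum; congr _%:C.
(* For n = 1 the first and last entries coincide; [lo] is then 0 by the convention in [ratio_lo], so
   nothing is counted twice. *)
case: n n_gt0 @hi @lo {E} hi_lo => // -[|n'] _ hi' lo' Ehl.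
  rewrite big_ord1 /= /lo' /ratio_lo eqxx mulr0 addr0.
  by [].
rewrite big_ord_recl big_ord_recr /= eqxx big1 ?add0r // => i _.
by rewrite /bump /= add1n eqSS ltn_eqF ?mulr0.
Qed.

Lemma eqdiag_y_norm : (eqdiag_y n g lam) ^t* *m eqdiag_y n g lam = 1%:M.
Proof.
apply/matrixP => i j; rewrite !ord1 [RHS]mxE eqxx.
have E := sum_y (fun=> 1).
have c1 : crow n (fun=> 1 : R) = const_mx 1 by apply/rowP => l; rewrite !mxE.
by rewrite c1 diag_const_mx mulmx1 !mul1r hi_lo in E.
Qed.

Lemma eqdiag_y_quad : (eqdiag_y n g lam) ^t* *m diag_mx (crow n lam)
  *m eqdiag_y n g lam = g%:C%:M.
Proof.
by apply/matrixP => i j; rewrite !ord1 [RHS]mxE eqxx mulr1n sum_y lam_hi_lo.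
Qed.

End Eqdiag_y.
End EqualDiagonal.

Section Columns.
Local Open Scope sesquilinear_scope.
Variable C : numClosedFieldType.

Definition first_cols M k (S : 'M[C]_M) : 'M[C]_(M, k) := S *m pid_mx k.

Lemma first_colsE M k (kM : (k <= M)%N) (S : 'M[C]_M) i j :
  first_cols k S i j = S i (widen_ord kM j).
Proof.
rewrite mxE (bigD1 (widen_ord kM j)) //= big1 => [|l lj].
  by rewrite !mxE /= eqxx ltn_ord mulr1 addr0.
by rewrite mxE -[(l == j :> nat)]/(l == widen_ord kM j) (negbTE lj) mulr0.
Qed.

Lemma first_cols_id M (S : 'M[C]_M) : first_cols M S = S.
Proof. by rewrite /first_cols pid_mx_1 mulmx1. Qed.

Lemma first_cols_snoc M k (kM : (k < M)%N) (S : 'M[C]_M) :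
  first_cols k.+1 S =
  castmx (erefl M, addn1 k) (row_mx (first_cols k S) (col (Ordinal kM) S)).
Proof.
apply/matrixP => i j; rewrite castmxE (first_colsE kM) !mxE /= cast_ord_id.
case: splitP => l /= El.
  rewrite (first_colsE (ltnW kM)); congr (S _ _); exact: val_inj.
by rewrite mxE; congr (S _ _); apply: val_inj; rewrite /= El ord1 addn0.
Qed.

Lemma orthonormal_snoc m k n (e : (k + 1 = n)%N) (Z : 'M[C]_(m, k)) (s : 'cV[C]_m) :
  Z ^t* *m Z = 1%:M -> Z ^t* *m s = 0 -> s ^t* *m s = 1%:M ->
  (castmx (erefl m, e) (row_mx Z s)) ^t* *m castmx (erefl m, e) (row_mx Z s)
  = 1%:M.
Proof.
case: n / e => ZZ Zs ss; rewrite castmx_id.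
have sZ : s ^t* *m Z = 0.
  by rewrite -(trmxCK (_ *m Z)) trmxC_mul trmxCK Zs trmx0 map_mx0.
by rewrite tr_row_mx map_col_mx mul_col_row ZZ Zs sZ ss -scalar_mx_block.
Qed.

(** Rows from k on vanish in the first k columns, so the Gram matrix is that of the leading k x k
    block. *)
Lemma upper_gram_cols M k (kM : (k <= M)%N) (U : 'M[C]_M) :
  (forall i j : 'I_M, (j < i)%N -> U i j = 0) ->
  \det ((first_cols k U) ^t* *m first_cols k U) =
  \prod_(j < k) `|U (widen_ord kM j) (widen_ord kM j)| ^+ 2.
Proof.
move=> U0.
pose Uk : 'M[C]_k := \matrix_(i, j) U (widen_ord kM i) (widen_ord kM j).
have -> : first_cols k U = (pid_mx k : 'M[C]_(M, k)) *m Uk.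
  apply/matrixP => i j; rewrite (first_colsE kM) mxE.
  have [ik|ki] := ltnP i k; last first.
    rewrite U0 ?(leq_trans (ltn_ord j)) // big1 // => l _.
    by rewrite mxE ltnNge ki andbF mul0r.
  rewrite (bigD1 (Ordinal ik)) //= big1 => [|l li].
    rewrite !mxE eqxx ik mul1r addr0; congr (U _ _); exact: val_inj.
  rewrite mxE; case: eqP => [il|]; last by rewrite mul0r.
  by case/eqP: li; apply: val_inj.
rewrite trmxC_mul -mulmxA (mulmxA ((pid_mx k) ^t*)) tr_pid_mx map_pid_mx.
rewrite mul_pid_mx minnn (minn_idPr kM) pid_mx_1 mul1mx det_mulmx det_trmxC.
rewrite mulrC -normCK det_upper_prod => [|i j ji]; last by rewrite mxE U0.
by rewrite normr_prod -prodrXl; apply: eq_bigr => j _; rewrite mxE.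
Qed.

Lemma det_gram_unitary n (A S : 'M[C]_n) : S ^t* *m S = 1%:M ->
  \det ((A *m S) ^t* *m (A *m S)) = \det (A ^t* *m A).
Proof.
move=> SS; rewrite trmxC_mul (_ : _ *m _ = S ^t* *m (A ^t* *m A) *m S); last first.
  by rewrite !mulmxA.
by rewrite [LHS]det_mulmx [LHS]mulrC -[LHS]det_mulmx [S *m _]mulmxA (mulmx1C SS) mul1mx.
Qed.

End Columns.

(** * Correctness of the column-by-column construction *)

Section AlgorithmA.
Local Open Scope sesquilinear_scope.
Local Open Scope complex_scope.
Variables (R : realType) (M : nat) (gam : nat -> R).
Local Notation C := R[i].
Hypothesis M_gt0 : (0 < M)%N.
Hypothesis gam_gt0 : forall l, (l < M)%N -> 0 < gam l.
Hypothesis gam_dec : forall i j, (i <= j < M)%N -> gam j <= gam i.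

Let G : 'M[C]_M := toC (diag_mx (\row_(l < M) gam l)).
Let g : R := (\prod_(k < M) gam k ^+ 2) `^ (M%:R^-1).

Let prod_gt0 : 0 < \prod_(k < M) gam k ^+ 2.
Proof. by apply: prodr_gt0 => k _; rewrite exprn_gt0 ?gam_gt0. Qed.

Let g_gt0 : 0 < g. Proof. exact: powR_gt0. Qed.

Let g_expM : g ^+ M = \prod_(k < M) gam k ^+ 2.
Proof.
by rewrite -powR_mulrn ?powR_ge0 // -powRrM mulVf ?powRr1 ?ltW // pnatr_eq0 -lt0n.
Qed.

Let GE : G = diag_mx (crow M gam). Proof. exact: toC_diag. Qed.

Let GHG : G ^t* *m G = diag_mx (crow M (fun l => gam l ^+ 2)).
Proof.
rewrite GE tr_diag_mx map_diag_mx mulmx_diag; congr diag_mx.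
apply/rowP => i; rewrite !mxE rmorphXn expr2; congr (_ * _).
exact: conjc_real.
Qed.

Let det_GHG : \det (G ^t* *m G) = (g ^+ M)%:C.
Proof.
rewrite GHG det_diag g_expM rmorph_prod.
by apply: eq_bigr => i _; rewrite mxE.
Qed.

(* By triangularity of U in Gamma S = Q U, the determinant is the product of
   the squares of the first k diagonal entries of U. *)
Definition partial_equal_diag k (S : 'M[C]_M) : Prop :=
  (first_cols k S) ^t* *m first_cols k S = 1%:M /\
  \det ((G *m first_cols k S) ^t* *m (G *m first_cols k S)) = (g ^+ k)%:C.

Definition step_data k (S : 'M[C]_M) (Zp : 'M[C]_(M, M - k))
    (V : 'M[C]_(M - k)) (lam : nat -> R) : Prop :=
  orth_compl_basis (first_cols k S) Zp /\
  eigdec (eqdiag_mx G (first_cols k S) Zp) V lam.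

Let gram_unit k S : partial_equal_diag k S ->
  (G *m first_cols k S) ^t* *m (G *m first_cols k S) \in unitmx.
Proof.
move=> [_ dN]; rewrite unitmxE unitfE dN (inj_eq (@complexI R) _ 0).
by rewrite gt_eqF // exprn_gt0.
Qed.

(** Dividing the full determinant g^M by the invariant g^k leaves g^(M-k). These are the facts under
    which [eqdiag_y] is a unit vector with quadratic value g. *)
Lemma step_lam k S Zp V lam : (k < M)%N -> partial_equal_diag k S ->
  @step_data k S Zp V lam ->
  [/\ forall l, (l < M - k)%N -> 0 <= lam l,
      forall i j, (i <= j < M - k)%N -> lam j <= lam i
    & \prod_(l < M - k) lam l = g ^+ (M - k)].
Proof.
move=> kM PkS [ocb dA]; have uN := gram_unit PkS; split.
- by apply: (eigdec_ge0 dA) => v; exact: eqdiag_mx_ge0.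
- by case: dA.
- have [ZZ dN] := PkS.
  have := det_gram_complement (subnKC (ltnW kM)) ZZ ocb uN.
  rewrite dN (eigdec_det dA) det_GHG -rmorphM => /complexI.
  rewrite -[in RHS](subnKC (ltnW kM)) exprD; apply: mulfI.
  by rewrite gt_eqF // exprn_gt0.
Qed.

Lemma step_orth k S Zp V lam (c : 'cV[C]_(M - k)) : @step_data k S Zp V lam ->
  (first_cols k S) ^t* *m (Zp *m V *m c) = 0.
Proof. by move=> [ocb _]; rewrite !mulmxA (orth_compl_basis_mul0 ocb) !mul0mx. Qed.

Lemma step_dot k S Zp V lam (c c' : 'cV[C]_(M - k)) : @step_data k S Zp V lam ->
  (Zp *m V *m c) ^t* *m (Zp *m V *m c') = c ^t* *m c'.
Proof.
move=> [[ZpZp _] [/unitarymxP/mulmx1C VV _ _]].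
rewrite !trmxC_mul -!mulmxA (mulmxA (Zp ^t*)) ZpZp mul1mx (mulmxA (V ^t*)) VV.
by rewrite mul1mx.
Qed.

Lemma partial_equal_diag_step k S Zp V lam (kM : (k < M)%N) :
  partial_equal_diag k S -> @step_data k S Zp V lam ->
  col (Ordinal kM) S = Zp *m V *m eqdiag_y (M - k) g lam ->
  partial_equal_diag k.+1 S.
Proof.
move=> PkS sd Ecol; have uN := gram_unit PkS.
have [lam_ge0 lam_dec lam_prod] := step_lam kM PkS sd.
have n_gt0 : (0 < M - k)%N by rewrite subn_gt0.
have [ZZ dN] := PkS.
rewrite /partial_equal_diag (first_cols_snoc kM) Ecol; split.
  apply: orthonormal_snoc => //; first exact: step_orth sd.
  by rewrite (step_dot _ _ sd) eqdiag_y_norm.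
set s := Zp *m V *m _.
have -> n (e : (k + 1 = n)%N) :
  \det ((G *m castmx (erefl M, e) (row_mx (first_cols k S) s)) ^t* *m
     (G *m castmx (erefl M, e) (row_mx (first_cols k S) s)))
  = \det ((G *m first_cols k S) ^t* *m (G *m first_cols k S))
    * \det (eqdiag_mx G (first_cols k S) s).
  by case: n / e; rewrite castmx_id det_gram_row_mx.
rewrite dN /s -mulmxA eqdiag_mx_mul; have [_ dA] := sd.
move: (eigdec_diag dA); move: (eqdiag_mx G _ _) => A EA.
rewrite (_ : _ *m A *m _ = (eqdiag_y (M - k) g lam) ^t* *m (V ^t* *m A *m V)
                            *m eqdiag_y (M - k) g lam); last first.
  by rewrite trmxC_mul !mulmxA.
rewrite EA eqdiag_y_quad //.
by rewrite det_scalar1 -rmorphM -exprSr.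
Qed.

Lemma partial_equal_diag0 S : partial_equal_diag 0 S.
Proof.
split; first by apply/matrixP => -[].
by rewrite det_mx00 expr0.
Qed.

(** With no column chosen the projector is the identity and A^(0) = Gamma^2, so the first column is
    an instance of the general step. The types mention [M - 0], hence the generalization over it. *)
Lemma step_data0 S : @step_data 0 S (pid_mx M) 1%:M (fun l => gam l ^+ 2).
Proof.
rewrite /step_data; move: (M - 0)%N (subn0 M) => n /esym En.
case: n / En; rewrite pid_mx_1; split.
  split; first by rewrite trmxC1 mulmx1.
  by move=> v; split=> _; [exists v; rewrite mul1mx|apply/matrixP => -[]].
split.
- by apply/unitarymxP; rewrite trmxC1 mulmx1.
- move=> i j ij; have [/andP[_ jM]] := (ij).
  have iM : (i < M)%N by case/andP: ij => + _; move/leq_ltn_trans; apply.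
  by rewrite ler_pXn2r ?nnegrE ?(ltW (gam_gt0 _)) ?gam_dec.
- rewrite trmxC1 mulmx1 mul1mx /eqdiag_mx mulmx1 /proj_perp.
  rewrite [X in _ - X *m _](_ : _ = 0); last first.
    by rewrite [invmx _]flatmx0 mulmx0.
  by rewrite mul0mx subr0 mulmx1 GHG (toC_diag _ (fun l => gam l ^+ 2)).
Qed.

Lemma first_step_col (lam : nat -> R) :
  (pid_mx M : 'M[C]_(M, M - 0)) *m 1%:M *m eqdiag_y (M - 0) g lam
  = eqdiag_y M g lam.
Proof.
move: (M - 0)%N (subn0 M) => n /esym En.
by case: n / En; rewrite pid_mx_1 !mul1mx.
Qed.

Let conj_real (x : R) : (x%:C)^*%R = x%:C. Proof. exact: conjc_real. Qed.

Lemma eqdiag_y_ylast (lam : nat -> R) n : n = 2%N ->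
  (eqdiag_y n g lam) ^t* *m eqdiag_ylast n g lam = 0 :> 'M[C]_1.
Proof.
move=> ->; apply/matrixP => i j; rewrite !ord1 !mxE !big_ord_recl big_ord0 !mxE /=.
by rewrite !conj_real -!rmorphM addr0 -rmorphD /= mulrN mulrC addNr.
Qed.

Lemma eqdiag_ylast_norm (lam : nat -> R) n : n = 2%N ->
  (eqdiag_ylast n g lam) ^t* *m eqdiag_ylast n g lam =
  (eqdiag_y n g lam) ^t* *m eqdiag_y n g lam :> 'M[C]_1.
Proof.
move=> ->; apply/matrixP => i j; rewrite !ord1 !mxE !big_ord_recl !big_ord0 !mxE /=.
by rewrite !conj_real -!rmorphM !addr0 -!rmorphD /= mulrNN addrC.
Qed.

(** Settles the last column without a quadratic form: unitarity fixes the full Gram determinant,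
    hence the last factor. *)
Lemma partial_equal_diag_unitary S : S ^t* *m S = 1%:M -> partial_equal_diag M S.
Proof.
by move=> SS; rewrite /partial_equal_diag first_cols_id det_gram_unitary // det_GHG.
Qed.

Lemma unitary_last_step S Zp V lam (k1 : (M - 2 < M)%N) (k2 : (M.-1 < M)%N) :
  (1 < M)%N -> partial_equal_diag (M - 2) S -> @step_data (M - 2) S Zp V lam ->
  col (Ordinal k1) S = Zp *m V *m eqdiag_y (M - (M - 2)) g lam ->
  col (Ordinal k2) S = Zp *m V *m eqdiag_ylast (M - (M - 2)) g lam ->
  S ^t* *m S = 1%:M.
Proof.
move=> M_gt1 PS sd E1 E2.
have e2 : (M - (M - 2) = 2)%N by rewrite subKn.
have [lam_ge0 lam_dec lam_prod] := step_lam k1 PS sd.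
have [ZZ1 _] := partial_equal_diag_step PS sd E1.
have em : M.-1 = (M - 2).+1 by rewrite -{1}(subnK M_gt1) addn2.
have [ZZ _] := PS.
suff: (first_cols M.-1.+1 S) ^t* *m first_cols M.-1.+1 S = 1%:M.
  by rewrite prednK // first_cols_id.
rewrite (first_cols_snoc k2); apply: orthonormal_snoc; first by rewrite em.
  rewrite E2 em (first_cols_snoc k1) E1.
  move: (M - 2).+1 (addn1 (M - 2)) => n e; case: n / e; rewrite castmx_id.
  rewrite tr_row_mx map_col_mx mul_col_mx (step_orth _ sd) (step_dot _ _ sd).
  by rewrite (eqdiag_y_ylast _ e2) col_mx0.
rewrite E2 (step_dot _ _ sd) eqdiag_ylast_norm // eqdiag_y_norm //.
by rewrite e2.
Qed.

Lemma equal_diag_unitary S : equal_diag gam S ->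
  S ^t* *m S = 1%:M /\ forall k, (k <= M)%N -> partial_equal_diag k S.
Proof.
rewrite /equal_diag -/G -/g => -[Zp [V [lam [[Z0 V0 lam0] col0 sd colk colM]]]].
have sdk k : (k <= M - 2)%N -> @step_data k S (Zp k) (V k) (lam k).
  case: k => [_|k kM]; last exact: sd.
  have -> : lam 0%N = fun l => gam l ^+ 2 by apply/funext.
  by rewrite Z0 V0; exact: step_data0.
have coly k (kM : (k < M)%N) : (k <= M - 2)%N ->
    col (Ordinal kM) S = Zp k *m V k *m eqdiag_y (M - k) g (lam k).
  case: k kM => [|k] kM k2; last exact: colk.
  have -> : lam 0%N = fun l => gam l ^+ 2 by apply/funext.
  by rewrite Z0 V0 first_step_col; apply: col0.
have Pk k : (k <= (M - 2).+1)%N -> partial_equal_diag k S.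
  elim: k => [_|k IHk]; first exact: partial_equal_diag0.
  rewrite ltnS => k2; have kM : (k < M)%N.
    by apply: leq_ltn_trans k2 _; rewrite ltn_subrL M_gt0.
  exact: partial_equal_diag_step (IHk (leqW k2)) (sdk _ k2) (coly _ kM k2).
have SS : S ^t* *m S = 1%:M.
  (* For M = 1 truncated subtraction gives M - 2 = 0, and the single general step already covers all
     columns. *)
  have [M1|M_gt1] := leqP M 1.
    have EM : M = 1%N by apply/anti_leq; rewrite M1 M_gt0.
    have [+ _] := Pk 1%N isT.
    by move: (1%N) EM => n EM; case: n / EM; rewrite first_cols_id.
  have k1 : (M - 2 < M)%N by rewrite ltn_subrL M_gt0.
  have k2 : (M.-1 < M)%N by rewrite prednK.
  apply: (@unitary_last_step S _ _ _ k1 k2 M_gt1 (Pk _ (leqW (leqnn _))) (sdk _ (leqnn _))).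
    exact: coly.
  exact: colM.
split=> // k kM; have [k2|] := leqP k (M - 2).+1; first exact: Pk.
move=> k2; have -> : k = M; last exact: partial_equal_diag_unitary.
apply/anti_leq; rewrite kM /=; apply: leq_trans k2.
by rewrite -add2n -leq_subLR.
Qed.

End AlgorithmA.

(** * The constant diagonal of the R-factor, and existence of an output *)

Section QR.
Local Open Scope sesquilinear_scope.
Local Open Scope complex_scope.
Variable R : realType.
Local Notation C := R[i].

Lemma QRdec_exists n (A : 'M[C]_n) : A \in unitmx -> exists Q U, QRdec A Q U.
Proof.
move=> uA; have [L [B [uB EL L0 Lge0]]] := schmidt_LQ (A ^t*) (leqnn n).
have detL : \prod_i L i i != 0.
  rewrite -det_lower_prod // -unitfE -unitmxE.
  have uAH : A ^t* \in unitmx by rewrite unitmx_trmxC.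
  by move: uAH; rewrite EL unitmx_mul => /andP[].
exists (B ^t*), (L ^t*); split.
- by rewrite trmxC_unitary.
- by move=> i j ji; rewrite !mxE L0 // conjC0.
- move=> i; rewrite !mxE geC0_conj // lt_neqAle Lge0 andbT eq_sym.
  by apply: contraNneq detL => Li; rewrite (bigD1 i) //= Li mul0r.
- by rewrite -trmxC_mul -EL trmxCK.
Qed.

Variables (M : nat) (gam : nat -> R).
Hypothesis M_gt0 : (0 < M)%N.
Hypothesis gam_gt0 : forall l, (l < M)%N -> 0 < gam l.
Hypothesis gam_dec : forall i j, (i <= j < M)%N -> gam j <= gam i.

Let G : 'M[C]_M := toC (diag_mx (\row_(l < M) gam l)).
Let g : R := (\prod_(k < M) gam k ^+ 2) `^ (M%:R^-1).

Let g_gt0 : 0 < g.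
Proof. by apply/powR_gt0/prodr_gt0 => k _; rewrite exprn_gt0 ?gam_gt0. Qed.

(** The products of the first k squared diagonal entries are g^k for every k, so consecutive ones
    isolate each entry; positivity selects the root. *)
Lemma QR_equal_diag (S Q U : 'M[C]_M) : equal_diag gam S -> QRdec (G *m S) Q U ->
  forall i, U i i = (Num.sqrt g)%:C.
Proof.
move=> /(equal_diag_unitary M_gt0 gam_gt0 gam_dec)[_ Pk] [uQ U0 Upos EQ] i.
have prodU k (kM : (k <= M)%N) :
    \prod_(j < k) `|U (widen_ord kM j) (widen_ord kM j)| ^+ 2 = (g ^+ k)%:C.
  have [_ <-] := Pk k kM; rewrite -/G /first_cols (mulmxA G) EQ -mulmxA.
  rewrite -(upper_gram_cols kM U0) -/(first_cols k U).
  move: (first_cols k U) => X; congr (\det _).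
  by rewrite trmxC_mul !mulmxA -(mulmxA (X ^t*)) (mulmx1C (unitarymxP uQ)) mulmx1.
have := prodU i.+1 (ltn_ord i); rewrite big_ord_recr /=.
under eq_bigr => j _.
  have -> : widen_ord (ltn_ord i) (widen_ord (leqnSn i) j) =
            widen_ord (ltnW (ltn_ord i)) j by apply: val_inj.
  over.
rewrite prodU (exprSr g i) rmorphM.
have -> : widen_ord (ltn_ord i) ord_max = i by apply: val_inj.
have gi0 : (g ^+ i)%:C != 0 by rewrite (inj_eq (@complexI R) _ 0) gt_eqF // exprn_gt0.
move=> /(mulfI gi0); rewrite ger0_norm ?(ltW (Upos i)) // => E.
have s0 : 0 <= (Num.sqrt g)%:C :> C by rewrite ler0c sqrtr_ge0.
apply/eqP; rewrite -(eqrXn2 (n := 2)) ?(ltW (Upos i)) //.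
by rewrite E -rmorphXn sqr_sqrtr ?(ltW g_gt0).
Qed.

(** The guards make the choice total in k and S, so that data can be picked before the invariant is
    known; at k = 0 they are pinned to the values prescribed by [equal_diag]. *)
Let step_exists k (S : 'M[C]_M) :
  exists t : 'M[C]_(M, M - k) * 'M[C]_(M - k) * (nat -> R),
    ((0 < k < M)%N -> partial_equal_diag gam k S ->
       step_data gam S t.1.1 t.1.2 t.2) /\
    (k = 0%N -> [/\ t.1.1 = pid_mx M, t.1.2 = 1%:M & t.2 = fun l => gam l ^+ 2]).
Proof.
have [->|k_gt0] := posnP k.
  by exists (pid_mx M, 1%:M, fun l => gam l ^+ 2); split.
have [kM|Mk] := ltnP k M; last first.
  by exists (pid_mx M, 1%:M, fun=> 0); split => // k0; rewrite k0 in k_gt0.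
have [PkS|] := pselect (partial_equal_diag gam k S); last first.
  by exists (pid_mx M, 1%:M, fun=> 0); split => // k0; rewrite k0 in k_gt0.
have [ZZ dN] := PkS.
have uN : (G *m first_cols k S) ^t* *m (G *m first_cols k S) \in unitmx.
  rewrite unitmxE unitfE dN (inj_eq (@complexI R) _ 0).
  by rewrite gt_eqF // exprn_gt0.
have [Zp ocb] := orth_compl_basis_exists ZZ (erefl (M - k)%N).
have [V [lam dA]] := hermitian_eigdec (eqdiag_mx_herm uN Zp).
by exists (Zp, V, lam); split => // k0; rewrite k0 in k_gt0.
Qed.

Let pick k S := sval (cid (step_exists k S)).
Let pickP k S := svalP (cid (step_exists k S)).

Let newcol k S : 'cV[C]_M :=
  (pick k S).1.1 *m (pick k S).1.2 *m eqdiag_y (M - k) g (pick k S).2.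

(** The data for column k' are picked at [build k'], before later columns exist. Their properties
    involve only the first k' columns, which later stages leave alone, so they transfer to the
    finished matrix. *)
Fixpoint build k : 'M[C]_M :=
  if k is k'.+1 then
    \matrix_(i, j) (if j == k' :> nat then newcol k' (build k') i 0 else build k' i j)
  else 0.

Let build_cols k n (S : 'M[C]_M) : (k <= n)%N -> (k <= M)%N ->
  (forall i (j : 'I_M), (j < k)%N -> S i j = build n i j) ->
  first_cols k S = first_cols k (build k).
Proof.
move=> kn kM ES; apply/matrixP => i j; rewrite !(first_colsE kM) ES //=.
elim: n kn {ES} => [k0|n IHn]; first by have := leq_trans (ltn_ord j) k0.
rewrite leq_eqVlt ltnS => /orP[/eqP<-//|kn].
by rewrite mxE /= ltn_eqF ?IHn // (leq_trans (ltn_ord j)).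
Qed.

Let partial_cols k (S S' : 'M[C]_M) : first_cols k S = first_cols k S' ->
  partial_equal_diag gam k S -> partial_equal_diag gam k S'.
Proof. by rewrite /partial_equal_diag => ->. Qed.

Let step_cols k (S S' : 'M[C]_M) Zp V lam : first_cols k S = first_cols k S' ->
  @step_data _ _ gam k S Zp V lam -> @step_data _ _ gam k S' Zp V lam.
Proof. by rewrite /step_data => ->. Qed.

Let pick_step k S : (k < M)%N -> partial_equal_diag gam k S ->
  step_data gam S (pick k S).1.1 (pick k S).1.2 (pick k S).2.
Proof.
move=> kM PkS; have [H1 H0] := pickP k S; rewrite -/(pick k S) in H0 H1.
case: k kM PkS H1 H0 => [|k] kM PkS H1 H0; last exact: H1.
by have [-> -> ->] := H0 erefl; exact: step_data0.
Qed.

Let build_partial k : (k <= M)%N -> partial_equal_diag gam k (build k).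
Proof.
elim: k => [|k IHk] kM; first exact: partial_equal_diag0.
have E : first_cols k (build k.+1) = first_cols k (build k).
  by apply: (@build_cols k k.+1) => //; exact: ltnW.
have Pk := IHk (ltnW kM).
apply: (partial_equal_diag_step M_gt0 gam_gt0 (kM := kM) (partial_cols (esym E) Pk)).
  exact: step_cols (esym E) (pick_step kM Pk).
by apply/matrixP => i j; rewrite ord1 [LHS]mxE mxE /= eqxx.
Qed.

Lemma equal_diag_exists : exists S : 'M[C]_M, equal_diag gam S.
Proof.
pose last_col := (pick (M - 2) (build (M - 2))).1.1
  *m (pick (M - 2) (build (M - 2))).1.2
  *m eqdiag_ylast (M - (M - 2)) g (pick (M - 2) (build (M - 2))).2.
(* For M >= 2 the last general column of [build M] is replaced by the prescribed companion, taken
   from the data of index M - 2; for M = 1 the only column is kept. *)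
pose S : 'M[C]_M := \matrix_(i, j)
  if (1 < M)%N && (j == M.-1 :> nat) then last_col i 0 else build M i j.
have lt_M1 k : (k <= M - 2)%N -> (1 < M)%N -> (k < M.-1)%N.
  move=> kM M1; rewrite -ltnS prednK // -(subnK M1) addn2.
  by rewrite !ltnS.
have ES k : (k <= M - 2)%N -> first_cols k S = first_cols k (build k).
  move=> kM; apply: (@build_cols k M); rewrite ?(leq_trans kM) ?leq_subr //.
  move=> i j jk; rewrite mxE; case: ifP => // /andP[M1 /eqP jM].
  by have := lt_M1 _ kM M1; rewrite -jM ltnNge ltnW.
have Ecol k (j : 'I_M) : (k <= M - 2)%N -> j = k :> nat ->
    col j S = newcol k (build k).
  move=> kM jk; apply/matrixP => i l; rewrite ord1 {l} [LHS]mxE [LHS]mxE.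
  case: ifP => [/andP[M1 /eqP jM]|_].
    by have := lt_M1 _ kM M1; rewrite -jk jM ltnn.
  have kM' : (k.+1 <= M)%N by rewrite -jk.
  have := @build_cols k.+1 M (build M) kM' kM' (fun _ _ _ => erefl).
  move=> /matrixP/(_ i (Ordinal (ltnSn k))); rewrite !(first_colsE kM').
  have -> : widen_ord kM' (Ordinal (ltnSn k)) = j by apply: val_inj.
  by move=> ->; rewrite /= mxE jk eqxx.
exists S.
exists (fun k => (pick k (build k)).1.1), (fun k => (pick k (build k)).1.2),
  (fun k => (pick k (build k)).2).
have [_ /(_ erefl)[Z0 V0 lam0]] := pickP 0%N (build 0); rewrite -/(pick _ _) in Z0 V0 lam0.
split.
- by split=> // l; rewrite lam0.
- move=> j j0; rewrite (Ecol 0%N) // /newcol Z0 V0 lam0.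
  exact: first_step_col.
- move=> k /andP[k0 kM].
  have kM' : (k < M)%N by apply: leq_ltn_trans kM _; rewrite ltn_subrL M_gt0.
  exact: (step_cols (esym (ES k kM)) (pick_step kM' (build_partial (ltnW kM')))).
- by move=> k j /andP[_ kM] jk; rewrite (Ecol k).
- move=> j M1 jM; apply/matrixP => i l; rewrite ord1 [LHS]mxE mxE M1 jM eqxx.
  by [].
Qed.

End QR.

(** * The MMSE design *)

Section Design.
Local Open Scope sesquilinear_scope.
Local Open Scope complex_scope.
Variable R : realType.
Local Notation C := R[i].

Lemma toC_mul m n p (A : 'M[R]_(m, n)) (B : 'M[R]_(n, p)) :
  toC (A *m B) = toC A *m toC B.
Proof. exact: map_mxM. Qed.

Lemma toC_trmxC m n (A : 'M[R]_(m, n)) : (toC A) ^t* = toC A^T.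
Proof. by apply/matrixP => i j; rewrite !mxE; exact: conjc_real. Qed.

Lemma toC1 n : toC (1%:M : 'M[R]_n) = 1%:M.
Proof. exact: map_mx1. Qed.

Lemma precoder_gram n m k (kn : (k <= n)%N) (V A : 'M[C]_n) (d : nat -> R)
    (X : 'M[C]_(k, m)) (Y : 'M[C]_m) :
  V ^t* *m A *m V = diag_mx (crow n d) ->
  (V *m pid_mx k *m X *m Y) ^t* *m A *m (V *m pid_mx k *m X *m Y) =
  Y ^t* *m (X ^t* *m diag_mx (crow k d) *m X) *m Y.
Proof.
move=> VAV.
have -> : diag_mx (crow k d) =
    (pid_mx k : 'M[C]_(n, k)) ^t* *m (V ^t* *m A *m V) *m pid_mx k.
  rewrite VAV tr_pid_mx map_pid_mx.
  apply/matrixP => i j; rewrite [RHS]mxE (bigD1 (widen_ord kn j)) //=.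
  rewrite big1 => [|l lj]; last first.
    rewrite [pid_mx _ l j]mxE.
    by rewrite -[(l == j :> nat)]/(l == widen_ord kn j) (negbTE lj) mulr0.
  rewrite mul_mx_diag !mxE /= eqxx !ltn_ord mulr1 addr0 andbT.
  rewrite -[(i == j :> nat)]/(i == j); case: eqP => [->|_].
    by rewrite mul1r mulr1n.
  by rewrite mul0r mulr0n.
by rewrite !trmxC_mul !mulmxA.
Qed.

Section WaterfillingGains.
Variables (M K : nat) (p0 : R) (lam : nat -> R).
Hypotheses (M_gt0 : (0 < M)%N) (M_le_K : (M <= K)%N) (p0_gt0 : 0 < p0).
Hypothesis lam_ge0 : forall l, (l < K)%N -> 0 <= lam l.
Hypothesis lam_dec : forall i j, (i <= j < K)%N -> lam j <= lam i.

Local Notation q := (water_q M K p0 lam).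
Local Notation Tq := (water_total M K p0 lam).
Local Notation Phi := (Phi_breve M K p0 lam).
Local Notation gam := (gamma M K p0 lam).

Let qM : (q <= M)%N := water_q_le M K p0 lam.

Lemma phi_sqr i : (i < q)%N -> phi M K p0 lam i ^+ 2 = q%:R^-1 * Tq - (lam i)^-1.
Proof.
move=> iq; rewrite sqr_sqrtr // subr_ge0.
exact/ltW/(water_level_gt M_le_K lam_ge0 lam_dec).
Qed.

Lemma Phi_breve_gram (d : nat -> R) :
  Phi^T *m diag_mx (\row_(i < q) d i) *m Phi =
  diag_mx (\row_i (if (i < q)%N then d i * phi M K p0 lam i ^+ 2 else 0)).
Proof.
have EPhi l i : Phi l i = phi M K p0 lam l * (l == i :> nat)%:R.
  by rewrite /Phi_breve mul_diag_mx !mxE ltn_ord andbT.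
apply/matrixP => i j; rewrite mxE [RHS]mxE [in RHS]mxE.
have E l : (Phi^T *m diag_mx (\row_(i < q) d i)) i l * Phi l j =
    Phi l i * d l * Phi l j.
  by rewrite mul_mx_diag mxE [Phi^T _ _]mxE [(\row__ _) _ _]mxE.
under eq_bigr do rewrite E !EPhi.
have [iq|qi] := ltnP i q; last first.
  rewrite mul0rn big1 // => l _.
  by rewrite (ltn_eqF (leq_trans (ltn_ord l) qi)) mulr0 !mul0r.
rewrite (bigD1 (Ordinal iq)) //= eqxx big1 => [|l li]; last first.
  have -> : (l == i :> nat) = false.
    by apply: contraNF li => /eqP e; apply/eqP/val_inj.
  by rewrite mulr0 !mul0r.
rewrite addr0 -val_eqE; case: eqP => _; last by rewrite !mulr0.
by rewrite /= !mulr1n; ring.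
Qed.

Lemma gamma_rowE (i : 'I_M) : gamma_row M K p0 lam 0 i = gam i.
Proof. by rewrite /gamma valK. Qed.

Lemma gamma_sqr i : (i < M)%N ->
  gam i ^+ 2 = if (i < q)%N then lam i * (q%:R^-1 * Tq) else 1.
Proof.
move=> iM; rewrite -(gamma_rowE (Ordinal iM)) mxE /Lambda_q Phi_breve_gram.
rewrite mxE [1%:M _ _]mxE mxE mxE eqxx mulr1n /=.
case: ifPn => [iq|_]; last by rewrite addr0 sqrtr1 expr1n.
have li := water_lam_gt0 M_le_K lam_ge0 lam_dec iq.
have E : 1 + lam i * phi M K p0 lam i ^+ 2 = lam i * (q%:R^-1 * Tq).
  by rewrite phi_sqr // mulrBr mulfV ?gt_eqF // addrC subrK.
by rewrite E sqr_sqrtr // -E addr_ge0 // mulr_ge0 ?sqr_ge0 ?(ltW li) //.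
Qed.

Lemma gamma_gt0 i : (i < M)%N -> 0 < gam i.
Proof.
move=> iM; have : gam i ^+ 2 != 0.
  rewrite gamma_sqr //; case: ifPn => [iq|_]; last exact: oner_neq0.
  have li := water_lam_gt0 M_le_K lam_ge0 lam_dec iq.
  rewrite !mulf_neq0 ?gt_eqF ?(water_total_gt0 M_le_K) // invr_gt0 ltr0n.
  exact: leq_trans (ltn0Sn _) iq.
rewrite expf_eq0 /= => gi; rewrite lt_neqAle eq_sym gi /=.
by rewrite -(gamma_rowE (Ordinal iM)) mxE sqrtr_ge0.
Qed.

Lemma gamma_dec i j : (i <= j < M)%N -> gam j <= gam i.
Proof.
move=> /andP[ij jM]; have iM := leq_ltn_trans ij jM.
rewrite -(@ler_pXn2r _ 2) ?nnegrE ?(ltW (gamma_gt0 _)) // !gamma_sqr //.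
have T0 := water_total_gt0 M_le_K p0_gt0 lam_ge0.
case: ifPn => [jq|]; case: ifPn => [iq|] //.
- rewrite ler_wpM2r ?mulr_ge0 ?invr_ge0 ?ler0n ?(ltW T0) //.
  by apply: lam_dec; rewrite ij (leq_trans jM).
- by rewrite (leq_ltn_trans ij jq).
- move=> _; have li := water_lam_gt0 M_le_K lam_ge0 lam_dec iq.
  rewrite -ler_pdivrMl // mulr1.
  exact/ltW/(water_level_gt M_le_K lam_ge0 lam_dec).
Qed.

(** The target g of the construction is thus 1/sigma^2, so the R-factor has diagonal 1/sigma and B =
    sigma U - I has zero diagonal. *)
Lemma gamma_geom_mean :
  (\prod_(k < M) gam k ^+ 2) `^ (M%:R^-1) = (sigma2 M K p0 lam)^-1.
Proof.
have s_gt0 := sigma2_gt0 M_le_K p0_gt0 lam_ge0 lam_dec.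
have sD := sigma2_expM M_gt0 M_le_K p0_gt0 lam_ge0 lam_dec.
have -> : \prod_(k < M) gam k ^+ 2 = (sigma2 M K p0 lam)^-1 ^+ M.
  have sM : sigma2 M K p0 lam ^+ M != 0 by rewrite expf_neq0 // gt_eqF.
  apply: (mulfI sM); rewrite exprVn mulfV // -[RHS]sD; congr (_ * _).
  under eq_bigr => k _ do rewrite gamma_sqr //.
  by rewrite -big_mkcond (big_ord_widen _ (fun i => lam i * (q%:R^-1 * Tq)) qM).
have s0 : 0 <= (sigma2 M K p0 lam)^-1 by rewrite invr_ge0 ltW.
by rewrite -powR_mulrn // -powRrM mulfV ?powRr1 // pnatr_eq0 -lt0n.
Qed.

Lemma gamma_rowP : gamma_row M K p0 lam = \row_(l < M) gam l.
Proof. by apply/rowP => i; rewrite gamma_rowE mxE. Qed.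

Lemma trace_Phi : \tr (Phi^T *m Phi) <= p0.
Proof.
have := Phi_breve_gram (fun=> 1).
have -> : \row_(i < q) (1 : R) = const_mx 1 by apply/rowP => i; rewrite !mxE.
rewrite diag_const_mx mulmx1 => ->; rewrite mxtrace_diag.
under eq_bigr do rewrite mxE mul1r.
rewrite -big_mkcond -(big_ord_widen _ (fun i => phi M K p0 lam i ^+ 2) qM).
under eq_bigr do rewrite phi_sqr //.
(* With q = 0 no power is spent, so the constraint is then slack. *)
have [->|q0] := posnP q; first by rewrite big_ord0 ltW.
rewrite sumrB sumr_const card_ord -[_ * _ *+ _]mulr_natl mulrA mulfV ?pnatr_eq0 -?lt0n //.
by rewrite mul1r /water_total addrK.
Qed.

End WaterfillingGains.

Section DesignProperties.
Variables (M P K : nat) (H : 'M[C]_(P, K)) (Rvv : 'M[C]_P) (p0 : R).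
Hypotheses (M_gt0 : (0 < M)%N) (M_le_K : (M <= K)%N) (p0_gt0 : 0 < p0).
Hypothesis Rvv_posdef : posdefmx Rvv.
Variables (lam : nat -> R) (V : 'M[C]_K) (Psi Q U : 'M[C]_M).
Hypothesis dH : eigdec (channel_gram H Rvv) V lam.
Hypothesis edPsi : equal_diag (gamma M K p0 lam) Psi.
Hypothesis qrU : QRdec (toC (diag_mx (gamma_row M K p0 lam)) *m Psi) Q U.

Local Notation q := (water_q M K p0 lam).
Local Notation s := (sigma2 M K p0 lam).
Let F : 'M[C]_(K, M) :=
  V *m pid_mx q *m toC (Phi_breve M K p0 lam) *m Psi.
Let B : 'M[C]_M := (Num.sqrt s)%:C *: U - 1%:M.

Let lam_ge0 := channel_lam_ge0 Rvv_posdef dH.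
Let lam_dec : forall i j, (i <= j < K)%N -> lam j <= lam i.
Proof. by case: dH. Qed.

Let s_gt0 : 0 < s. Proof. exact: sigma2_gt0. Qed.

Let gam_gt0 := gamma_gt0 M_le_K p0_gt0 lam_ge0 lam_dec.
Let gam_dec := gamma_dec M_le_K p0_gt0 lam_ge0 lam_dec.

Let PsiPsi : Psi ^t* *m Psi = 1%:M.
Proof. by case: (equal_diag_unitary M_gt0 gam_gt0 gam_dec edPsi). Qed.

Let Udiag i : U i i = (Num.sqrt s^-1)%:C.
Proof.
have qrU' := qrU; rewrite gamma_rowP in qrU'.
by rewrite (QR_equal_diag M_gt0 gam_gt0 gam_dec edPsi qrU') gamma_geom_mean.
Qed.

(** Stated for any matrix diagonalized by [V] because it serves twice: the channel Gram matrix gives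
    the error covariance, the identity with d = 1 the transmitted power. *)
Let F_gram (A : 'M[C]_K) (d : nat -> R) : V ^t* *m A *m V = diag_mx (crow K d) ->
  F ^t* *m A *m F = Psi ^t* *m toC ((Phi_breve M K p0 lam)^T
    *m diag_mx (\row_(i < q) d i) *m Phi_breve M K p0 lam) *m Psi.
Proof.
have qK := leq_trans (water_q_le M K p0 lam) M_le_K.
move=> /(precoder_gram qK) ->; move: (Phi_breve _ _ _ _) => X.
by rewrite toC_trmxC -toC_diag -!toC_mul.
Qed.

Lemma design_bdfd : mmse_bdfd H Rvv p0 F B (mmse_receiver H Rvv F B).
Proof.
have [_ U0 _ _] := qrU; split => //.
- move=> i j; rewrite !mxE leq_eqVlt => /orP[/eqP/val_inj->|ji].
    rewrite Udiag eqxx -rmorphM -sqrtrM ?(ltW s_gt0) // mulfV ?gt_eqF //.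
    by rewrite sqrtr1 subrr.
  by rewrite U0 // mulr0 -val_eqE /= gtn_eqF // subr0.
- rewrite mxtrace_mulC -[F ^t*]mulmx1 (@F_gram _ (fun=> 1)); last first.
    rewrite mulmx1; have [/unitarymxP/mulmx1C -> _ _] := dH.
    by apply/matrixP => i j; rewrite !mxE.
  rewrite mxtrace_mulC mulmxA (mulmx1C PsiPsi) mul1mx.
  have -> : \row_(i < q) (1 : R) = const_mx 1 by apply/rowP => i; rewrite !mxE.
  rewrite diag_const_mx mulmx1 trace_map_mx lecR.
  exact: trace_Phi.
Qed.

(** As Gamma^2 = I + Phi^T Lambda Phi and Psi is unitary, I + F^H A F = (Gamma Psi)^H (Gamma Psi) =
    U^H U. With B + I = sigma U the factors U cancel. *)
Lemma design_Ree : Ree H Rvv F B = (s%:C)%:M.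
Proof.
rewrite (ReeE); pose Gam := toC (diag_mx (gamma_row M K p0 lam)).
have EU : 1%:M + F ^t* *m channel_gram H Rvv *m F = U ^t* *m U.
  rewrite (F_gram (eigdec_diag dH)) -PsiPsi -{1}[Psi ^t*]mulmx1 -mulmxDl -mulmxDr.
  have -> : 1%:M + toC ((Phi_breve M K p0 lam)^T
      *m diag_mx (\row_(i < q) lam i) *m Phi_breve M K p0 lam) = Gam ^t* *m Gam.
    rewrite /Gam gamma_rowP toC_trmxC tr_diag_mx -toC_mul mulmx_diag -toC1 /toC -map_mxD.
    congr map_mx; rewrite Phi_breve_gram -diag_const_mx -raddfD; congr diag_mx.
    apply/rowP => i; rewrite !mxE.
    rewrite -expr2 gamma_sqr //; case: ifPn => [iq|_]; last by rewrite addr0.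
    have li := water_lam_gt0 M_le_K lam_ge0 lam_dec iq.
    rewrite (phi_sqr M_le_K lam_ge0 lam_dec iq) mulrBr mulfV ?gt_eqF //.
    by rewrite addrC subrK.
  have [uQ _ _ EQ] := qrU; rewrite -/Gam in EQ.
  have -> : Psi ^t* *m (Gam ^t* *m Gam) *m Psi = (Gam *m Psi) ^t* *m (Gam *m Psi).
    by rewrite trmxC_mul !mulmxA.
  by rewrite EQ trmxC_mul !mulmxA -(mulmxA (U ^t*)) (mulmx1C (unitarymxP uQ)) mulmx1.
have uU : U \in unitmx.
  have [_ U0 Upos _] := qrU.
  rewrite unitmxE det_upper_prod // unitfE; apply/prodf_neq0 => i _.
  by rewrite gt_eqF.
have aUH : ((Num.sqrt s)%:C *: U) ^t* = (Num.sqrt s)%:C *: U ^t*.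
  by apply/matrixP => i j; rewrite !mxE rmorphM /=; congr (_ * _); exact: conjc_real.
rewrite EU /B subrK invmx_mul ?unitmx_trmxC // aUH.
rewrite -!scalemxAl -scalemxAr scalerA -rmorphM -expr2 sqr_sqrtr ?(ltW s_gt0) //.
rewrite mulmxA mulmxV // mul1mx mulVmx ?unitmx_trmxC //.
by rewrite scalemx1.
Qed.
End DesignProperties.
End Design.

(** * Convexity of the bit error rate *)

Section GaussianTail.
Variable R : realType.
Local Open Scope classical_set_scope.
Implicit Types (x y : R).
Let mu := @lebesgue_measure R.

Lemma erfcE (x : \bar R) : erfc x =
  2 / Num.sqrt pi * \int[mu]_(z in [set z : R | (x <= z%:E)%E]) gauss_fun z.
Proof. by []. Qed.

Lemma measurable_ge_ereal (x : \bar R) : measurable [set z : R | (x <= z%:E)%E].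
Proof.
case: x => [x| |].
- rewrite (_ : [set _ | _] = `[x, +oo[%classic); first exact: measurable_itv.
  by apply/seteqP; split => z /=; rewrite in_itv/= andbT lee_fin.
- by rewrite (_ : [set _ | _] = set0) //; apply/seteqP; split.
- rewrite (_ : [set _ | _] = setT) //; apply/seteqP; split=> // z _ /=.
  exact: leNye.
Qed.

Lemma erfc_y : erfc (+oo%E : \bar R) = 0.
Proof.
rewrite erfcE (_ : [set _ | _] = set0) ?Rintegral_set0 ?mulr0 //.
by apply/seteqP; split.
Qed.

Let c_gt0 : 0 < 2 / Num.sqrt pi :> R.
Proof. by rewrite divr_gt0 // sqrtr_gt0 pi_gt0. Qed.

Let integrable_gauss D : measurable D -> mu.-integrable D (EFin \o @gauss_fun R).
Proof.
by move=> mD; apply: (integrableS measurableT) => //; exact: integrableT_gauss.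
Qed.

Lemma erfc_ge0 (x : \bar R) : 0 <= erfc x.
Proof.
rewrite erfcE mulr_ge0 ?(ltW c_gt0) //; apply: Rintegral_ge0 => z _.
exact: gauss_fun_ge0.
Qed.

Lemma erfc_antitone (x y : \bar R) : (x <= y)%E -> erfc y <= erfc x.
Proof.
move=> xy; rewrite !erfcE ler_pM2l //.
have mx := measurable_ge_ereal x; have my := measurable_ge_ereal y.
have fi D : measurable D -> (\int[mu]_(z in D) (gauss_fun z)%:E)%E \is a fin_num.
  by move=> mD; apply: integrable_fin_num => //; exact: integrable_gauss.
rewrite /Rintegral fine_le ?fi // ge0_subset_integral //.
- by apply/measurable_EFinP/measurable_funTS; exact: measurable_gauss_fun.
- by move=> z _; rewrite lee_fin gauss_fun_ge0.
- by move=> z /= yz; apply: le_trans yz.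
Qed.

(** Turns the tail into a function of an upper end point, the form to which [continuous_FTC1]
    applies. *)
Let erfc_itv x : erfc x%:E = 2 / Num.sqrt pi *
  (\int[mu]_z gauss_fun z - \int[mu]_(z in `]-oo, x]) gauss_fun z).
Proof.
rewrite erfcE; congr (_ * _).
rewrite (_ : [set z : R | (x%:E <= z%:E)%E] = `[x, +oo[%classic); last first.
  by apply/seteqP; split => z /=; rewrite in_itv/= andbT lee_fin.
have := @Rintegral_itvB _ (@gauss_fun R) -oo%O +oo%O x.
rewrite set_itvE => -> //; last exact: integrable_gauss.
rewrite Rintegral_itv_obnd_cbnd //.
by apply: integrable_gauss.
Qed.

Lemma is_derive_erfc x :
  is_derive x 1 (fun y => erfc y%:E) (- (2 / Num.sqrt pi) * gauss_fun x).
Proof.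
have [] := @continuous_FTC1 _ (@gauss_fun R) -oo%O x (x + 1).
- by rewrite ltrDl.
- exact: integrable_gauss.
- by rewrite ltNyr.
- exact: continuous_gauss_fun.
move=> dF DF.
have -> : (fun y => erfc y%:E) = (fun y => 2 / Num.sqrt pi *
  (\int[mu]_z gauss_fun z - \int[mu]_(z in `]-oo, y]) gauss_fun z)).
  by apply/funext => y; exact: erfc_itv.
pose F y := \int[mu]_(z in `]-oo, y]) gauss_fun z.
pose A := \int[mu]_z @gauss_fun R z.
have dFx : is_derive x 1 F (gauss_fun x).
  by apply: DeriveDef; [exact: dF|rewrite -derive1E; exact: DF].
have -> : (fun y => 2 / Num.sqrt pi *
    (A - \int[mu]_(z in `]-oo, y]) gauss_fun z)) =
    (2 / Num.sqrt pi) \*: (cst A - F) by [].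
apply: is_derive_eq.
by rewrite sub0r scalerN mulNr.
Qed.

Lemma erfc_lt_eventually (e : R) : 0 < e -> exists n : nat, erfc (n%:R : R)%:E < e.
Proof.
move=> e0; pose k : R := 2 / Num.sqrt pi.
have cv : (\int[mu]_(x in `[0%R, n%:R]) (gauss_fun x)%:E)%E @[n --> \oo] -->
    (Num.sqrt pi / 2)%:E.
  rewrite -integral0y_gauss; apply: ge0_cvgn_integral.
    exact: gauss_fun_ge0.
  exact: measurable_gauss_fun.
have ek : 0 < e / k by rewrite divr_gt0.
have cv' : (\int[mu]_(x in `[0%R, n%:R]) gauss_fun x) @[n --> \oo] --> Num.sqrt pi / 2.
  exact: fine_cvg cv.
have [n _ /(_ n (leqnn n)) Hn] := cvgr_dist_lt _ _ cv' _ ek.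
exists n; rewrite erfcE -/k mulrC -ltr_pdivlMr //.
apply: le_lt_trans Hn; apply: le_trans (ler_norm _).
rewrite (_ : [set z : R | (n%:R%:E <= z%:E)%E] = `[n%:R, +oo[%classic); last first.
  by apply/seteqP; split => z /=; rewrite in_itv/= andbT lee_fin.
have := @Rintegral_itvB _ (@gauss_fun R) (BLeft 0) +oo%O n%:R.
rewrite Rintegral_itv_obnd_cbnd; last exact: integrable_gauss.
move=> <- //; last by rewrite bnd_simp.
  by rewrite /Rintegral integral0y_gauss.
exact: integrable_gauss.
Qed.

End GaussianTail.

Section Convexity.
Local Open Scope classical_set_scope.
Variable R : realType.
Implicit Types (f D : R -> R) (x y a b c k t tau : R).

(** The mean value theorem on [a, c] and on [c, b] gives slopes D u and D v with u < v; the gap in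
    the inequality is (D v - D u)(c - a)(b - c). *)
Lemma chord_of_derive_nondecreasing f D tau :
  (forall x, 0 < x -> x < tau -> is_derive x 1 f (D x)) ->
  (forall x y, 0 < x -> x <= y -> y < tau -> D x <= D y) ->
  forall a c b, 0 < a -> a < c -> c < b -> b < tau ->
  f c * (b - a) <= f a * (b - c) + f b * (c - a).
Proof.
move=> dfD Dmono a c b a0 ac cb bt.
have mvt u v : 0 < u -> u < v -> v < tau ->
    exists2 w, u < w < v & f v - f u = D w * (v - u).
  move=> u0 uv vt.
  have df w : u <= w -> w <= v -> is_derive w 1 f (D w).
    by move=> uw wv; apply: dfD; [exact: lt_le_trans uw|exact: le_lt_trans vt].
  have dfuv w : w \in `]u, v[%R -> is_derive w 1 f (D w).
    by rewrite in_itv/= => /andP[uw wv]; apply: df; exact: ltW.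
  have cf : {within `[u, v], continuous f}.
    apply: derivable_within_continuous => w; rewrite in_itv/= => /andP[uw wv].
    by have := df w uw wv.
  by have [w] := MVT uv dfuv cf; rewrite in_itv/=; exists w.
have [u /andP[au uc] Eu] := mvt a c a0 ac (lt_trans cb bt).
have [v /andP[cv vb] Ev] := mvt c b (lt_trans a0 ac) cb bt.
have Duv : D u <= D v.
  by apply: Dmono; [exact: lt_trans au|exact/ltW/(lt_trans uc)|exact: lt_trans bt].
rewrite -subr_ge0.
have -> : f a * (b - c) + f b * (c - a) - f c * (b - a) =
    (D v - D u) * ((c - a) * (b - c)).
  have -> : f b = f c + D v * (b - c) by rewrite -Ev addrC subrK.
  have -> : f c = f a + D u * (c - a) by rewrite -Eu addrC subrK.
  ring.
by rewrite !mulr_ge0 ?subr_ge0 // ltW.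
Qed.

Lemma convex_of_chord f tau :
  (forall a c b, 0 <= a -> a < c -> c < b -> b < tau ->
    f c * (b - a) <= f a * (b - c) + f b * (c - a)) ->
  forall a b t, 0 <= a < tau -> 0 <= b < tau -> 0 <= t <= 1 ->
  f (t * a + (1 - t) * b) <= t * f a + (1 - t) * f b.
Proof.
move=> chord.
have main a b t : 0 <= a -> b < tau -> a < b -> 0 <= t <= 1 ->
    f (t * a + (1 - t) * b) <= t * f a + (1 - t) * f b.
  move=> a0 bt ab /andP[t0 t1].
  have [->|t_neq0] := eqVneq t 0; first by rewrite subr0 !mul0r !mul1r !add0r.
  have [->|t_neq1] := eqVneq t 1; first by rewrite subrr !mul0r !mul1r !addr0.
  have {t0}t0 : 0 < t by rewrite lt_neqAle eq_sym t_neq0.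
  have {t1}t1 : t < 1 by rewrite lt_neqAle t_neq1.
  set c := t * a + (1 - t) * b.
  have ca : c - a = (1 - t) * (b - a) by rewrite /c; ring.
  have bc : b - c = t * (b - a) by rewrite /c; ring.
  have ba0 : 0 < b - a by rewrite subr_gt0.
  have ac : a < c by rewrite -subr_gt0 ca mulr_gt0 // subr_gt0.
  have cb : c < b by rewrite -subr_gt0 bc mulr_gt0.
  rewrite -(ler_pM2r ba0); apply: le_trans (chord _ _ _ a0 ac cb bt) _.
  by rewrite ca bc le_eqVlt; apply/orP; left; apply/eqP; ring.
move=> a b t /andP[a0 at_] /andP[b0 bt] t01.
have [ab|ba|->] := ltgtP a b.
- exact: main.
- have := main b a (1 - t) b0 at_ ba; rewrite subKr.
  rewrite [(1 - t) * b + _]addrC [(1 - t) * f b + _]addrC; apply.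
  by case/andP: t01 => t0 t1; rewrite subr_ge0 t1 lerBlDr lerDl.
- by rewrite -!mulrDl addrC subrK !mul1r.
Qed.

(** Both terms of the error rate have this form, with k = beta and, since 3 sqrt(t) = sqrt(9 t),
    with k = 9 beta. *)
Definition erfc_snr k x : R := erfc (Num.sqrt (k * (x^-1 - 1)))%:E.

Lemma is_derive_erfc_snr k x : 0 < k -> 0 < x -> x < 1 ->
  is_derive x 1 (erfc_snr k) (k / Num.sqrt pi *
    (expR (- (k * (x^-1 - 1))) * x^-1 ^+ 2 / Num.sqrt (k * (x^-1 - 1)))).
Proof.
move=> k0 x0 x1; have u0 : 0 < k * (x^-1 - 1).
  by rewrite mulr_gt0 // subr_gt0 invf_gt1.
have d1 : is_derive x 1 (k \*: ((fun y => y^-1) - cst 1)) (k * - x ^- 2).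
  have dV : is_derive x 1 (fun y : R => y^-1) (- x ^- 2 *: 1).
    by apply: (@is_deriveV _ id); rewrite ?gt_eqF.
  by apply: is_derive_eq; rewrite subr0 /GRing.scale /= mulr1.
have d2 := is_derive1_sqrt u0.
have d3 := is_derive_erfc (Num.sqrt (k * (x^-1 - 1))).
have := @is_derive1_comp _ _ _ x _ _ d3 (@is_derive1_comp _ _ _ x _ _ d2 d1).
move=> d4; apply: (is_derive_eq d4).
rewrite /gauss_fun sqr_sqrtr ?ltW //.
have spi : Num.sqrt pi != 0 :> R by rewrite gt_eqF // sqrtr_gt0 pi_gt0.
have su : Num.sqrt (k * (x^-1 - 1)) != 0 by rewrite gt_eqF // sqrtr_gt0.
set E := expR _; set S := Num.sqrt (k * _) in su *.
field; by rewrite spi su gt_eqF.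
Qed.

Lemma erfc_snr_mono k x y : 0 <= k -> 0 < x -> x <= y -> erfc_snr k x <= erfc_snr k y.
Proof.
move=> k0 x0 xy; apply: erfc_antitone; rewrite lee_fin ler_wsqrtr //.
by rewrite ler_wpM2l // lerD2r lef_pV2 ?posrE // (lt_le_trans x0).
Qed.

Lemma erfc_snr_lt k (e c : R) : 0 < k -> 0 < e -> 0 < c ->
  exists2 a, 0 < a < c & erfc_snr k a < e.
Proof.
move=> k0 e0 c0; have [n Hn] := @erfc_lt_eventually R e e0.
have n0 : 0 < n%:R ^+ 2 / k + 1 :> R by rewrite ltr_wpDl // divr_ge0 ?sqr_ge0 // ltW.
(* The second bound gives k (1/a - 1) >= n^2, so the argument of erfc is at least n; c/2 keeps a
   below c. *)
pose a := Num.min (c / 2) (n%:R ^+ 2 / k + 1)^-1.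
have a0 : 0 < a by rewrite lt_min divr_gt0 //= invr_gt0.
exists a.
  by rewrite a0 /= gt_min ltr_pdivrMr // ltr_pMr // ltr1n.
apply: le_lt_trans Hn; apply: erfc_antitone; rewrite lee_fin.
rewrite -[leLHS](ger0_norm (ler0n _ n)) -sqrtr_sqr ler_wsqrtr //.
rewrite mulrC -ler_pdivrMr // lerBrDr.
rewrite -[leLHS]invrK lef_pV2 ?posrE ?invr_gt0 //.
by rewrite ge_min lexx orbT.
Qed.

(* With [u = 1/x - 1] the derivative is [e^(-ku) (1+u)^2 / sqrt u] up to a
   constant; it decreases in [u >= 3/(2k)] because
   [(v/u)^3 <= e^(2k(v-u))] and [(1+v)/(1+u) <= v/u] for [u <= v]. *)
Lemma snr_derive_decreasing k (u v : R) : 0 < k -> 3 / (2 * k) <= u -> u <= v ->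
  expR (- (k * v)) * (1 + v) ^+ 2 / Num.sqrt (k * v) <=
  expR (- (k * u)) * (1 + u) ^+ 2 / Num.sqrt (k * u).
Proof.
move=> k0 ku uv.
have u0 : 0 < u by apply: lt_le_trans ku; rewrite divr_gt0 // mulr_gt0.
have v0 : 0 < v := lt_le_trans u0 uv.
(* v/u = 1 + (v - u)/u, and the lower bound on u is exactly 1/u <= 2k/3. *)
have ratio : v / u <= expR (2 / 3 * k * (v - u)).
  apply: le_trans (expR_ge1Dx _); rewrite ler_pdivrMr //.
  have ku' : 3 <= u * (2 * k) by rewrite -ler_pdivrMr // mulr_gt0.
  have : 0 <= (v - u) * (u * (2 * k) - 3) by rewrite mulr_ge0 // subr_ge0.
  by lra.
have cube : v ^+ 3 * expR (- (k * v)) ^+ 2 <= u ^+ 3 * expR (- (k * u)) ^+ 2.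
  have -> : expR (- (k * u)) ^+ 2 =
      expR (2 / 3 * k * (v - u)) ^+ 3 * expR (- (k * v)) ^+ 2.
    by rewrite -!expRM_natl -expRD; congr expR; field.
  rewrite mulrA ler_wpM2r ?sqr_ge0 // -exprMn ler_pXn2r ?nnegrE ?(ltW v0) //.
    by rewrite mulrC -ler_pdivrMr.
  by rewrite mulr_ge0 ?expR_ge0 // ltW.
have nonneg w : 0 < w -> 0 <= expR (- (k * w)) * (1 + w) ^+ 2 / Num.sqrt (k * w).
  by move=> w0; rewrite divr_ge0 ?sqrtr_ge0 // mulr_ge0 ?expR_ge0 ?sqr_ge0.
(* Squaring removes the roots; after multiplication by u^3 v^3 the claim is the product of [cube]
   and [fourth], times k. *)
rewrite -(@ler_pXn2r _ 2) ?nnegrE ?nonneg // !expr_div_n !sqr_sqrtr ?mulr_ge0 ?(ltW k0)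
  ?(ltW u0) ?(ltW v0) //.
rewrite ![(expR _ * _) ^+ 2]exprMn -![(_ ^+ 2) ^+ 2]exprM [(2 * 2)%N]/=.
set Ev := expR (- (k * v)) ^+ 2 in cube *; set Eu := expR (- (k * u)) ^+ 2 in cube *.
have Ev0 : 0 <= Ev by exact: sqr_ge0.
have Eu0 : 0 <= Eu by exact: sqr_ge0.
have fourth : u ^+ 4 * (1 + v) ^+ 4 <= v ^+ 4 * (1 + u) ^+ 4.
  rewrite -!exprMn ler_pXn2r ?nnegrE ?mulr_ge0 ?addr_ge0 ?(ltW u0) ?(ltW v0) //.
  by rewrite !mulrDr !mulr1 [v * u]mulrC lerD2r.
rewrite ler_pdivrMr ?mulr_gt0 // [leRHS]mulrAC ler_pdivlMr ?mulr_gt0 //.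
rewrite -(@ler_pM2l _ (u ^+ 3 * v ^+ 3)) ?mulr_gt0 ?exprn_gt0 //.
have := ler_pM _ _ cube fourth.
rewrite !mulr_ge0 ?exprn_ge0 ?(ltW u0) ?(ltW v0) ?addr_ge0 ?(ltW u0) ?(ltW v0) // => /(_ isT isT) H.
have := ler_wpM2l (ltW k0) H; congr (_ <= _); ring.
Qed.

End Convexity.

(** * Convexity and monotonicity of the error rate, and Jensen's inequality *)

Section BitErrorRate.
Variable R : realType.
Local Open Scope classical_set_scope.
Implicit Types (x y a b c k t tau : R).

(** In the real field 0^-1 = 0 and the root of a negative number is 0, so [erfc_snr] at 0 is erfc 0;
    the intended value is erfc(+oo) = 0. *)
Definition erfc_snr0 k x : R := if x == 0 then 0 else erfc_snr k x.

Lemma erfc_snr_ge0 k x : 0 <= erfc_snr k x. Proof. exact: erfc_ge0. Qed.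

Lemma erfc_snr0_mono k x y : 0 <= k -> 0 <= x -> x <= y ->
  erfc_snr0 k x <= erfc_snr0 k y.
Proof.
move=> k0 x0 xy; rewrite /erfc_snr0.
have [_|x_neq0] := eqVneq x 0; first by case: ifP => // _; exact: erfc_snr_ge0.
have x_gt0 : 0 < x by rewrite lt_neqAle eq_sym x_neq0.
by rewrite gt_eqF ?erfc_snr_mono // (lt_le_trans x_gt0).
Qed.

Section Chord.
Variables (k beta : R).
Hypotheses (beta_gt0 : 0 < beta) (beta_le_k : beta <= k).
Let tau := 2 * beta / (2 * beta + 3).

Let k_gt0 : 0 < k. Proof. exact: lt_le_trans beta_le_k. Qed.

Let tau_lt1 : tau < 1.
Proof. by rewrite ltr_pdivrMr ?mul1r ?ltrDl // addr_gt0 // mulr_gt0. Qed.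

Let snr_gt x : 0 < x -> x < tau -> 3 / (2 * k) <= x^-1 - 1.
Proof.
move=> x0 xt; have b2 : 0 < 2 * beta by rewrite mulr_gt0.
apply: (@le_trans _ _ (3 / (2 * beta))).
  by rewrite ler_wpM2l // lef_pV2 ?posrE ?mulr_gt0 // ler_wpM2l.
rewrite lerBrDr (_ : 3 / (2 * beta) + 1 = tau^-1).
  by rewrite lef_pV2 ?posrE ?(ltW xt) // (lt_trans x0).
rewrite /tau invf_div; field.
by rewrite gt_eqF.
Qed.

Lemma erfc_snr_chord a c b : 0 < a -> a < c -> c < b -> b < tau ->
  erfc_snr k c * (b - a) <= erfc_snr k a * (b - c) + erfc_snr k b * (c - a).
Proof.
pose D x := k / Num.sqrt pi *
  (expR (- (k * (x^-1 - 1))) * x^-1 ^+ 2 / Num.sqrt (k * (x^-1 - 1))).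
have dD x : 0 < x -> x < tau -> is_derive x 1 (erfc_snr k) (D x).
  by move=> x0 xt; apply: is_derive_erfc_snr => //; exact: lt_trans tau_lt1.
apply: (chord_of_derive_nondecreasing dD) => x y x0 xy yt; rewrite /D.
rewrite ler_wpM2l ?divr_ge0 ?sqrtr_ge0 ?(ltW k_gt0) //.
have y0 := lt_le_trans x0 xy.
have vu : y^-1 - 1 <= x^-1 - 1 by rewrite lerD2r lef_pV2 ?posrE.
have := snr_derive_decreasing k_gt0 (snr_gt y0 yt) vu.
by rewrite !(addrC 1) !subrK.
Qed.

Lemma erfc_snr0_chord a c b : 0 <= a -> a < c -> c < b -> b < tau ->
  erfc_snr0 k c * (b - a) <= erfc_snr0 k a * (b - c) + erfc_snr0 k b * (c - a).
Proof.
move=> a0 ac cb bt; have c0 := le_lt_trans a0 ac; have b0 := lt_trans c0 cb.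
rewrite /erfc_snr0 !(gt_eqF c0, gt_eqF b0).
have [->|a_neq0] := eqVneq a 0; last first.
  by apply: erfc_snr_chord => //; rewrite lt_neqAle eq_sym a_neq0.
rewrite mul0r add0r !subr0; apply/ler_addgt0Pr => e e0.
have bc0 : 0 < b - c by rewrite subr_gt0.
have [a' /andP[a'0 a'c] Ha'] := erfc_snr_lt k_gt0 (divr_gt0 e0 bc0) c0.
have H := erfc_snr_chord a'0 a'c cb bt.
have mono : erfc_snr k c <= erfc_snr k b.
  by apply: erfc_snr_mono; rewrite // ltW.
have He : erfc_snr k a' * (b - c) <= e by rewrite -ler_pdivlMr // ltW.
have Hm : 0 <= a' * (erfc_snr k b - erfc_snr k c).
  by rewrite mulr_ge0 ?subr_ge0 // ltW.
move: H mono He Hm.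
move: (erfc_snr k a') (erfc_snr k b) (erfc_snr k c) => fa fb fc.
lra.
Qed.

Lemma erfc_snr0_convex a b t : 0 <= a < tau -> 0 <= b < tau -> 0 <= t <= 1 ->
  erfc_snr0 k (t * a + (1 - t) * b) <=
  t * erfc_snr0 k a + (1 - t) * erfc_snr0 k b.
Proof. exact/convex_of_chord/erfc_snr0_chord. Qed.

End Chord.

Section Constellation.
Variable b : nat.
Hypothesis b_ge1 : (1 <= b)%N.

Let four_gt1 : 1 < 4 ^+ b :> R.
Proof. by rewrite exprn_egt1 ?ltr1n // -lt0n. Qed.

Let sqrt4b : Num.sqrt (4 ^+ b) = 2 ^+ b :> R.
Proof.
have -> : 4 = 2 ^+ 2 :> R by rewrite -natrX.
by rewrite -exprM mulnC exprM sqrtr_sqr ger0_norm // exprn_ge0.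
Qed.

Let two_le : 2 <= 2 ^+ b :> R.
Proof. by rewrite -{1}(expr1 2) ler_eXn2l // ltr1n. Qed.

Lemma ber_beta_gt0 : 0 < ber_beta R b.
Proof. by rewrite divr_gt0 ?subr_gt0 // mulr_gt0 // ltr0n. Qed.

Lemma ber_alpha_ge0 : 0 <= ber_alpha R b.
Proof.
rewrite /ber_alpha sqrt4b divr_ge0 ?mulr_ge0 ?exprn_ge0 ?ler0n // subr_ge0.
by rewrite (le_trans _ two_le) // ler1n.
Qed.

Lemma ber_zeta_ge0 : 0 <= ber_zeta R b.
Proof.
by rewrite /ber_zeta sqrt4b divr_ge0 ?mulr_ge0 ?exprn_ge0 ?ler0n // subr_ge0.
Qed.

Lemma ber_termE x : 0 <= x ->
  ber_term b x = ber_alpha R b * erfc_snr0 (ber_beta R b) x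
                 + ber_zeta R b * erfc_snr0 (9 * ber_beta R b) x.
Proof.
move=> x0; rewrite /ber_term /ber_arg /erfc_snr0 inver.
have [_|x_neq0] := eqVneq x 0.
  rewrite addye // gt0_muley ?lte_fin ?ber_beta_gt0 //= gt0_muley ?lte_fin //.
  by rewrite erfc_y.
rewrite -EFinB -EFinM /= -EFinM /erfc_snr; congr (_ + _ * erfc _%:E).
rewrite -mulrA [in RHS]sqrtrM //; congr (_ * _).
have -> : 9 = 3 ^+ 2 :> R by rewrite -natrX.
by rewrite sqrtr_sqr ger0_norm.
Qed.

Lemma ber_term_mono x y : 0 <= x -> x <= y -> ber_term b x <= ber_term b y.
Proof.
move=> x0 xy; have b0 := ltW ber_beta_gt0; rewrite !ber_termE ?(le_trans x0) //.
apply: lerD; apply: ler_wpM2l; rewrite ?ber_alpha_ge0 ?ber_zeta_ge0 //.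
  exact: erfc_snr0_mono.
by apply: erfc_snr0_mono => //; rewrite mulr_ge0.
Qed.

Lemma ber_term_convex x y t : 0 <= x < tau_min R b -> 0 <= y < tau_min R b ->
  0 <= t <= 1 ->
  ber_term b (t * x + (1 - t) * y) <= t * ber_term b x + (1 - t) * ber_term b y.
Proof.
move=> xt yt t01; have b0 := ber_beta_gt0.
have [[/andP[x0 _] /andP[y0 _]] /andP[t0 t1]] := ((conj xt yt), t01).
have z0 : 0 <= t * x + (1 - t) * y by rewrite addr_ge0 ?mulr_ge0 ?subr_ge0.
have C1 := erfc_snr0_convex b0 (lexx _) xt yt t01.
have b9 : ber_beta R b <= 9 * ber_beta R b by rewrite ler_peMl ?(ltW b0) // ler1n.
have C2 := erfc_snr0_convex b0 b9 xt yt t01.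
have := ler_wpM2l ber_alpha_ge0 C1; have := ler_wpM2l ber_zeta_ge0 C2.
rewrite !ber_termE //.
set a1 := erfc_snr0 _ (_ + _); set a2 := erfc_snr0 _ (_ + _).
move=> H2 H1; apply: le_trans (lerD H1 H2) _; clear H1 H2 C1 C2 a1 a2.
move: (erfc_snr0 _ _) (erfc_snr0 _ _) (erfc_snr0 _ _) (erfc_snr0 _ _).
move: (ber_alpha _ _) (ber_zeta _ _) => al ze p1 p2 p3 p4.
by rewrite le_eqVlt; apply/orP; left; apply/eqP; ring.
Qed.

Lemma ber_convex_below_tau_min (M : nat) : ber_convex_below b M (tau_min R b).
Proof.
move=> t x y; rewrite !inE /= => xt yt.
have -> : conv t (ber b x : R^o) (ber b y) = M%:R^-1 *
    \sum_(i < M) (t%:num * ber_term b (x 0 i) + (1 - t%:num) * ber_term b (y 0 i)).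
  by rewrite convRE big_split -!mulr_sumr mulrDr !(mulrCA M%:R^-1).
rewrite /ber ler_wpM2l ?invr_ge0 ?ler0n //.
apply: ler_sum => i _; rewrite !mxE.
by apply: ber_term_convex => //; rewrite ge0 le1.
Qed.

Lemma tau_min_bounds : 0 < tau_min R b <= 1.
Proof.
have b0 := ber_beta_gt0; have b2 : 0 < 2 * ber_beta R b by rewrite mulr_gt0.
have b3 : 0 < 2 * ber_beta R b + 3 by rewrite addr_gt0.
by rewrite divr_gt0 //= ler_pdivrMr // mul1r lerDl.
Qed.

Lemma ber_const (M : nat) x : (0 < M)%N ->
  ber b (const_mx x : 'rV[R]_M) = ber_term b x.
Proof.
move=> M0; rewrite /ber; under eq_bigr do rewrite mxE.
by rewrite sumr_const card_ord -(mulr_natl (ber_term b x)) mulKf // pnatr_eq0 -lt0n.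
Qed.

(** Extracts scalar convexity from a threshold about which nothing else is known: on constant
    vectors the mean of the terms is a single term. *)
Lemma ber_convex_const (M : nat) tau x y t : (0 < M)%N -> ber_convex_below b M tau ->
  0 <= x < tau -> 0 <= y < tau -> 0 <= t <= 1 ->
  ber_term b (t * x + (1 - t) * y) <= t * ber_term b x + (1 - t) * ber_term b y.
Proof.
move=> M0 cvx xt yt /andP[t0 t1].
pose t' : {i01 R} := Itv01 t0 t1.
have := cvx t' (const_mx x) (const_mx y); rewrite !inE /=.
move=> /(_ (fun i => _) (fun i => _)).
rewrite !ber_const // convRE /=.
have -> : conv t' (const_mx x : convex_lmodType 'rV[R]_M) (const_mx y) =
   const_mx (t * x + (1 - t) * y) by apply/matrixP => i j; rewrite !mxE.
rewrite ber_const //; apply=> i; by rewrite mxE.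
Qed.

(** The range of the mean is part of the claim: the induction needs it to apply convexity again, and
    it later places sigma^2 below the threshold. *)
Lemma jensen_ord (f : R -> R) tau n (x : 'I_n -> R) :
  (forall x y t, 0 <= x < tau -> 0 <= y < tau -> 0 <= t <= 1 ->
     f (t * x + (1 - t) * y) <= t * f x + (1 - t) * f y) ->
  (0 < n)%N -> (forall i, 0 <= x i < tau) ->
  0 <= n%:R^-1 * \sum_i x i < tau /\
  f (n%:R^-1 * \sum_i x i) <= n%:R^-1 * \sum_i f (x i).
Proof.
move=> cvx; case: n x => // n x _; elim: n x => [|n IHn] x xt.
  by rewrite !big_ord1 invr1 !mul1r; split.
have [mt Hf] := IHn (fun i => x (lift ord0 i)) (fun i => xt _).
pose t : R := n.+2%:R^-1.
have n2 : n.+2%:R != 0 :> R by rewrite pnatr_eq0.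
have n1 : n.+1%:R != 0 :> R by rewrite pnatr_eq0.
have t01 : 0 <= t <= 1 by rewrite invr_ge0 ler0n invf_le1 ?ltr0n // ler1n.
have avg (g : 'I_n.+2 -> R) : n.+2%:R^-1 * \sum_i g i =
    t * g ord0 + (1 - t) * (n.+1%:R^-1 * \sum_(i < n.+1) g (lift ord0 i)).
  rewrite big_ord_recl mulrDr; congr (_ + _).
  rewrite mulrA; congr (_ * _); rewrite /t.
  move: n1 n2; rewrite -[n.+2%:R]natr1; move: (n.+1%:R : R) => N N0 N1.
  by field; rewrite N0 N1.
rewrite !avg; set m := n.+1%:R^-1 * _ in mt Hf *; split.
  have [[/andP[x0 xtau] /andP[m0 mtau]] /andP[t0 t1]] := ((conj (xt ord0) mt), t01).
  have t1' : 0 <= 1 - t by rewrite subr_ge0.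
  rewrite addr_ge0 ?(mulr_ge0 t0 x0) ?(mulr_ge0 t1' m0) //=.
  have [->|t_neq0] := eqVneq t 0; first by rewrite mul0r add0r subr0 mul1r.
  have t_gt0 : 0 < t by rewrite lt_neqAle eq_sym t_neq0.
  have -> : tau = t * tau + (1 - t) * tau by ring.
  by rewrite ltr_leD ?ltr_pM2l // ler_wpM2l // ltW.
apply: le_trans (cvx _ _ _ (xt ord0) mt t01) _.
by rewrite lerD2l ler_wpM2l // subr_ge0; case/andP: t01.
Qed.

End Constellation.
End BitErrorRate.

(** * Existence and optimality of the design *)

Local Open Scope complex_scope.

Theorem mainTheorem6 (R : realType) (M P K b : nat) (p0 : R)
    (H : 'M[R[i]]_(P, K)) (Rvv : 'M[R[i]]_P)
    (M_gt0 : (0 < M)%N) (M_le : (M <= minn P K)%N) (b_ge1 : (1 <= b)%N)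
    (p0_gt0 : 0 < p0) (Rvv_posdef : posdefmx Rvv) :
  [/\ (exists tau : R,
         [/\ 0 < tau <= 1, tau_min R b <= tau & ber_convex_below b M tau]),
      (exists (lam : nat -> R) (F : 'M[R[i]]_(K, M)) (B : 'M[R[i]]_M)
              (W : 'M[R[i]]_(M, P)),
         mmse_design H Rvv p0 lam F B W)
    & forall (lam : nat -> R) (F : 'M[R[i]]_(K, M)) (B : 'M[R[i]]_M)
             (W : 'M[R[i]]_(M, P)),
        mmse_design H Rvv p0 lam F B W ->
        [/\ mmse_bdfd H Rvv p0 F B W,
            Ree H Rvv F B = ((sigma2 M K p0 lam)%:C)%:M,
            (forall (F' : 'M[R[i]]_(K, M)) (B' : 'M[R[i]]_M)
                    (W' : 'M[R[i]]_(M, P)),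
               mmse_bdfd H Rvv p0 F' B' W' ->
               \tr (Ree H Rvv F B) / M%:R <= \tr (Ree H Rvv F' B') / M%:R)
          & forall tau : R, 0 < tau <= 1 -> ber_convex_below b M tau ->
            forall (F' : 'M[R[i]]_(K, M)) (B' : 'M[R[i]]_M)
                   (W' : 'M[R[i]]_(M, P)),
              mmse_bdfd H Rvv p0 F' B' W' ->
              (forall i, mse H Rvv F' B' 0 i < tau) ->
              (forall i, mse H Rvv F B 0 i < tau) /\
              ber b (mse H Rvv F B) <= ber b (mse H Rvv F' B')]].
Proof.
have M_le_K : (M <= K)%N := leq_trans M_le (geq_minr P K).
split.
- exists (tau_min R b); split; [exact: tau_min_bounds|exact: lexx|].
  exact: ber_convex_below_tau_min.
- have [V [lam dH]] := hermitian_eigdec (channel_gram_herm H Rvv_posdef).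
  have lam_ge0 := channel_lam_ge0 Rvv_posdef dH.
  have [_ lam_dec _] := dH.
  have gam_gt0 := gamma_gt0 M_le_K p0_gt0 lam_ge0 lam_dec.
  have gam_dec := gamma_dec M_le_K p0_gt0 lam_ge0 lam_dec.
  have [Psi edPsi] := equal_diag_exists M_gt0 gam_gt0 gam_dec.
  have [PsiPsi _] := equal_diag_unitary M_gt0 gam_gt0 gam_dec edPsi.
  have uA : toC (diag_mx (gamma_row M K p0 lam)) *m Psi \in unitmx.
    rewrite unitmx_mul (mulmx1_unit PsiPsi).2 andbT gamma_rowP toC_diag.
    rewrite unitmxE det_diag unitfE; apply/prodf_neq0 => i _.
    by rewrite mxE (inj_eq (@complexI R) _ 0) gt_eqF ?gam_gt0.
  have [Q [U qrU]] := QRdec_exists uA.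
  by exists lam; do 3!eexists; exists V, Psi, Q, U; split.
move=> lam F B W [V [Psi [Q [U [dH edPsi qrU [EF EB EW]]]]]].
have HRee : Ree H Rvv F B = ((sigma2 M K p0 lam)%:C)%:M.
  by rewrite EF EB; exact: (design_Ree M_gt0 M_le_K p0_gt0 Rvv_posdef dH edPsi qrU).
have Hmse : mse H Rvv F B = const_mx (sigma2 M K p0 lam).
  by apply/rowP => i; rewrite [LHS]mxE [RHS]mxE HRee mxE eqxx.
have trE : \tr (Ree H Rvv F B) / M%:R = (sigma2 M K p0 lam)%:C.
  rewrite HRee mxtrace_scalar -[_ *+ M]mulr_natr mulfK //.
  by rewrite pnatr_eq0 -lt0n.
have mean_ge (F' : 'M[R[i]]_(K, M)) (B' : 'M[R[i]]_M) W' :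
    mmse_bdfd H Rvv p0 F' B' W' ->
    sigma2 M K p0 lam <= M%:R^-1 * \sum_i mse H Rvv F' B' 0 i.
  move=> [suB trF _]; rewrite [leRHS]mulrC.
  exact: (mse_mean_ge Rvv_posdef dH M_gt0 M_le_K p0_gt0 suB trF).
split; [|exact: HRee| |].
- by rewrite EW EF EB; exact: (design_bdfd M_gt0 M_le_K p0_gt0 Rvv_posdef dH edPsi qrU).
- move=> F' B' W' /mean_ge s_le; rewrite trE (tr_Ree Rvv_posdef dH).
  rewrite -(rmorph_nat (real_complex R)) -fmorphV -rmorphM /= lecR.
  by rewrite mulrC.
move=> tau /andP[tau0 tau1] cvx F' B' W' bd mse_lt.
have s_le := mean_ge _ _ _ bd.
have mse01 i : 0 <= mse H Rvv F' B' 0 i < tau.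
  by rewrite mse_lt andbT; case: (Ree_diag Rvv_posdef dH F' B' i).
have [/andP[_ m_lt] jensen] := jensen_ord
  (fun x y t => @ber_convex_const R b M tau x y t M_gt0 cvx) M_gt0 mse01.
(* sigma^2 is at most the mean error of the competitor, which is below [tau]; hence the design is in
   the convex regime as soon as one competitor is. *)
have s_lt := le_lt_trans s_le m_lt.
rewrite Hmse ber_const //; split=> [i|]; first by rewrite mxE.
apply: le_trans jensen; apply: ber_term_mono => //.
have [_ lam_dec _] := dH.
exact/ltW/(sigma2_gt0 M_le_K p0_gt0 (channel_lam_ge0 Rvv_posdef dH) lam_dec).
Qed.
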